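(* Let $\Gamma=(V,E,m)$ be an even, finite Artin graph of FC-type, and let $G_\Gamma$ be the Artin group based on $\Gamma$. If $P_1$ and $P_2$ are parabolic subgroups of $G_\Gamma$, then $P_1\cap P_2$ is a parabolic subgroup of $G_\Gamma$.
   Context: An Artin graph $\Gamma=(V,E,m)$ consists of a set $V$ of vertices, a set $E$ of two-element subsets of $V$ (edges), and a labelling $m\colon E\to\{2,3,4,\dots\}$; write $m_{u,v}=m(\{u,v\})$. It is finite if $V$ is finite, and even if all labels are even. Let $\mathrm{prod}(u,v,n)$ denote the prefix of length $n$ of the infinite alternating word $uvuvuv\cdots$. The Artin group based on $\Gamma$ is $$G_\Gamma=\langle V\mid \mathrm{prod}(u,v,m_{u,v})=\mathrm{prod}(v,u,m_{u,v})\ \ \forall \{u,v\}\in E\rangle,$$ and the Coxeter group $C_\Gamma$ is the quotient of $G_\Gamma$ by the additional relations $v^2=1$ for all $v\in V$. $\Gamma$ is of spherical type if $C_\Gamma$ is finite. For $S\subseteq V$, $G_S$ denotes the subgroup of $G_\Gamma$ generated by $S$ (a standard parabolic subgroup; by a theorem of Van der Lek it is canonically the Artin group of the subgraph of $\Gamma$ induced by $S$). A subgroup is parabolic if it equals $gG_Sg^{-1}$ for some $g\in G_\Gamma$ and $S\subseteq V$. $\Gamma$ is of FC-type if every induced complete subgraph of $\Gamma$ is of spherical type; for even $\Gamma$ this is equivalent to: in every triangle $\{u,v\},\{v,w\},\{w,u\}\in E$ at least two of $m_{u,v},m_{v,w},m_{w,u}$ equal $2$. *)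

(* Defs.v *)
From HB Require Import structures.
From mathcomp Require Import all_boot.
From mathcomp Require Import boolp classical_sets cardinality.

Set Implicit Arguments.
Unset Strict Implicit.
Unset Printing Implicit Defensive.

Local Open Scope group_scope.
Local Open Scope classical_set_scope.

(* Words in the generators and their formal inverses: (v, false) stands for v
   and (v, true) for v^-1. *)
Definition word (V : Type) := seq (V * bool).

Definition inv_letter (V : Type) (a : V * bool) : V * bool := (a.1, ~~ a.2).

Definition inv_word (V : Type) (w : word V) : word V :=
  rev (map (@inv_letter V) w).

Section Presentation.
Variables (V : choiceType) (R : set (word V * word V)).

Inductive pres_eq : word V -> word V -> Prop :=
| pres_refl w : pres_eq w w
| pres_sym w1 w2 : pres_eq w1 w2 -> pres_eq w2 w1
| pres_trans w1 w2 w3 : pres_eq w1 w2 -> pres_eq w2 w3 -> pres_eq w1 w3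
| pres_cat w1 w1' w2 w2' :
    pres_eq w1 w1' -> pres_eq w2 w2' -> pres_eq (w1 ++ w2) (w1' ++ w2')
| pres_cancel a : pres_eq [:: a; inv_letter a] [::]
| pres_rel r : R r -> pres_eq r.1 r.2.

Lemma inv_letterK : involutive (@inv_letter V).
Proof. by case=> v b; rewrite /inv_letter /= negbK. Qed.

Lemma inv_wordK : involutive (@inv_word V).
Proof.
move=> w; rewrite /inv_word map_rev revK -map_comp map_id_in // => a _ /=.
exact: inv_letterK.
Qed.

Lemma pres_mulwV w : pres_eq (w ++ inv_word w) [::].
Proof.
elim: w => [|a w IHw]; first exact: pres_refl.
have -> : (a :: w) ++ inv_word (a :: w) =
          [:: a] ++ ((w ++ inv_word w) ++ [:: inv_letter a]).
  by rewrite /inv_word /= rev_cons -cats1 !catA.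
apply: pres_trans (pres_cancel a).
apply: (@pres_cat [:: a] [:: a] _ [:: inv_letter a]); first exact: pres_refl.
by apply: (@pres_cat _ [::]) => //; exact: pres_refl.
Qed.

Lemma pres_mulVw w : pres_eq (inv_word w ++ w) [::].
Proof. by rewrite -{2}[w]inv_wordK; apply: pres_mulwV. Qed.

Lemma pres_inv w1 w2 :
  pres_eq w1 w2 -> pres_eq (inv_word w1) (inv_word w2).
Proof.
move=> w12; rewrite -[inv_word w1]cats0.
apply: (@pres_trans _ (inv_word w1 ++ (w2 ++ inv_word w2))).
  by apply: pres_cat; [exact: pres_refl | apply/pres_sym/pres_mulwV].
rewrite catA -[X in pres_eq _ X]cat0s; apply: pres_cat; last exact: pres_refl.
apply: pres_trans (pres_mulVw w1).
by apply: pres_cat; [exact: pres_refl | exact: pres_sym].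
Qed.

Definition pres_eqb : rel (word V) := fun w1 w2 => `[< pres_eq w1 w2 >].

Lemma pres_eqb_equiv : equiv_class_of pres_eqb.
Proof.
split=> [w|w1 w2|w2 w1 w3]; first exact/asboolP/pres_refl.
  by apply/asboolP/asboolP => /pres_sym.
by move=> /asboolP w12 /asboolP w23; apply/asboolP/(pres_trans w12).
Qed.

Canonical pres_equiv := EquivRelPack pres_eqb_equiv.

Definition pres_group : Type := {eq_quot pres_equiv}%qT.

HB.instance Definition _ := Choice.on pres_group.

Definition pres_class (w : word V) : pres_group := 
  (\pi_({eq_quot pres_equiv}) w)%qT.

Lemma pres_classP w1 w2 : pres_class w1 = pres_class w2 <-> pres_eq w1 w2.
Proof.
by split=> [/eqquotP/asboolP|w12] //; apply/eqquotP/asboolP.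
Qed.

Definition pres_word (x : pres_group) : word V :=
  repr (x : {eq_quot pres_equiv}%qT).

Lemma pres_wordK : cancel pres_word pres_class.
Proof. exact: reprK. Qed.

Lemma pres_classK w : pres_eq (pres_word (pres_class w)) w.
Proof. by apply/pres_classP; rewrite pres_wordK. Qed.

Definition pres_one : pres_group := pres_class [::].
Definition pres_mul (x y : pres_group) : pres_group :=
  pres_class (pres_word x ++ pres_word y).
Definition pres_invg (x : pres_group) : pres_group :=
  pres_class (inv_word (pres_word x)).

Lemma pres_mulE w1 w2 :
  pres_mul (pres_class w1) (pres_class w2) = pres_class (w1 ++ w2).
Proof. by apply/pres_classP/pres_cat; apply: pres_classK. Qed.

Lemma pres_invE w : pres_invg (pres_class w) = pres_class (inv_word w).
Proof. by apply/pres_classP/pres_inv/pres_classK. Qed.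

Lemma pres_mulA : associative pres_mul.
Proof.
move=> x y z; rewrite -(pres_wordK x) -(pres_wordK y) -(pres_wordK z).
by rewrite !pres_mulE catA.
Qed.

Lemma pres_mul1 : left_id pres_one pres_mul.
Proof. by move=> x; rewrite -(pres_wordK x) pres_mulE. Qed.

Lemma pres_mulg1 : right_id pres_one pres_mul.
Proof. by move=> x; rewrite -(pres_wordK x) pres_mulE cats0. Qed.

Lemma pres_mulV : left_inverse pres_one pres_invg pres_mul.
Proof.
move=> x; rewrite -(pres_wordK x) pres_invE pres_mulE.
exact/pres_classP/pres_mulVw.
Qed.

Lemma pres_mulgV : right_inverse pres_one pres_invg pres_mul.
Proof.
move=> x; rewrite -(pres_wordK x) pres_invE pres_mulE.
exact/pres_classP/pres_mulwV.
Qed.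

HB.instance Definition _ := isGroup.Build pres_group
  pres_mulA pres_mul1 pres_mulg1 pres_mulV pres_mulgV.

Definition pres_gen (v : V) : pres_group := pres_class [:: (v, false)].

End Presentation.

Definition is_subgroup (G : groupType) (H : set G) : Prop :=
  [/\ H 1, forall x y, H x -> H y -> H (x * y) & forall x, H x -> H x^-1].

Definition subgroup_gen (G : groupType) (A : set G) : set G :=
  smallest (@is_subgroup G) A.

(* [label] is only meaningful on [edges]; its other values are never used. *)
Record artin_graph := ArtinGraph {
  vertex : finType;
  edges : {set {set vertex}};
  label : {set vertex} -> nat;
  edge_card : forall e, e \in edges -> #|e| = 2;
  label_ge2 : forall e, e \in edges -> 2 <= label e }.

Definition even_graph (Gamma : artin_graph) : Prop :=
  forall e : {set vertex Gamma}, e \in edges Gamma -> ~~ odd (label e).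

Section InducedSubgraph.
Variables (Gamma : artin_graph) (S : {set vertex Gamma}).
Implicit Type e : {set {v : vertex Gamma | v \in S}}.

Definition lift_edge e : {set vertex Gamma} := [set val v | v in e]%SET.

Definition induced_edges : {set {set {v : vertex Gamma | v \in S}}} :=
  [set e | lift_edge e \in edges Gamma]%SET.

Lemma induced_edge_card e : e \in induced_edges -> #|e| = 2.
Proof.
by rewrite inE => /edge_card; rewrite card_imset //; apply: val_inj.
Qed.

Lemma induced_label_ge2 e :
  e \in induced_edges -> 2 <= label (lift_edge e).
Proof. by rewrite inE; apply: label_ge2. Qed.

Definition induced_subgraph : artin_graph :=
  ArtinGraph induced_edge_card induced_label_ge2.

Definition induces_complete : Prop :=
  forall u v, u \in S -> v \in S -> u != v -> [set u; v]%SET \in edges Gamma.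

End InducedSubgraph.

(* The prefix of length n of the word uvuvuv... *)
Fixpoint alt_word (V : Type) (u v : V) (n : nat) : word V :=
  if n is n'.+1 then (u, false) :: alt_word v u n' else [::].

Definition artin_rels (Gamma : artin_graph) :
    set (word (vertex Gamma) * word (vertex Gamma)) :=
  [set r | exists u v : vertex Gamma,
     let e := [set u; v]%SET in
     e \in edges Gamma /\
     r = (alt_word u v (label e), alt_word v u (label e))].

Definition square_rels (V : Type) : set (word V * word V) :=
  [set r | exists v : V, r = ([:: (v, false); (v, false)], [::])].

Definition artin_group (Gamma : artin_graph) : groupType :=
  pres_group (@artin_rels Gamma).

Definition coxeter_group (Gamma : artin_graph) : groupType :=
  pres_group (@artin_rels Gamma `|` @square_rels (vertex Gamma)).

Definition spherical_type (Gamma : artin_graph) : Prop :=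
  finite_set [set: coxeter_group Gamma].

Definition FC_type (Gamma : artin_graph) : Prop :=
  forall S : {set vertex Gamma},
    induces_complete S -> spherical_type (induced_subgraph S).

Definition artin_gen (Gamma : artin_graph) (v : vertex Gamma) :
    artin_group Gamma :=
  pres_gen (@artin_rels Gamma) v.

Definition standard_parabolic (Gamma : artin_graph)
    (S : {set vertex Gamma}) : set (artin_group Gamma) :=
  subgroup_gen [set artin_gen v | v in [set` S]].

Definition parabolic (Gamma : artin_graph) (P : set (artin_group Gamma)) :
    Prop :=
  exists (g : artin_group Gamma) (S : {set vertex Gamma}),
    P = [set g * x * g^-1 | x in standard_parabolic S].

(* Main.v *)
From HB Require Import structures.
Require Import Defs.
From mathcomp Require Import all_boot ssralg ssrint zify.
From mathcomp Require Import boolp classical_sets cardinality.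

Set Implicit Arguments.
Unset Strict Implicit.
Unset Printing Implicit Defensive.

Local Open Scope group_scope.

(** Write G_S for the standard parabolic subgroup on a set S of vertices. All
    labels are even, so sending the vertices outside S to 1 respects the
    relations and gives a retraction of the Artin group onto G_S. Retractions
    yield G_S /\ G_T = G_(S /\ T), and they show that, up to conjugation, every
    intersection of two parabolic subgroups has the form G_S /\ k G_S k^-1; if
    moreover k retracts to 1 on S, this is the centralizer of k in G_S.

    The proof is an induction on the size of T, where G_T contains both
    parabolic subgroups. If u and n are nonadjacent vertices of T, then G_T is
    the free product of G_(T - n) and G_(T - u) amalgamated over G_(T - u - n).
    All that is used of this splitting is that reduced words represent elements
    outside the amalgamated subgroup ([amalgam_notin]). It has two consequences.
    First, two parabolic subgroups contained in conjugates of the factors have a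
    parabolic intersection ([meet_side_conjugates]): in terms of the Bass-Serre
    tree, elements of the intersection fix a path, and one moves along that path
    using the induction hypothesis in the factors. Second, for every k, either
    G_S /\ k G_S k^-1 is contained in a conjugate of a factor, hence is
    parabolic, or k lies in G_S G_(T - u - n) G_S ([meet_conj_dichotomy]).

    The case of a proper subset S of T reduces to S = T - x for a single vertex
    x ([meet_conj_proper]). If x has a nonneighbour in T, the splitting along
    this pair concludes. Otherwise the second consequence is applied until k
    lies in some G_Y whose vertices other than x are adjacent to all of T; then
    k may be assumed to retract to 1 on T - x. Here the FC condition enters: a
    triangle has at most one label different from 2 ([FC_triangle]). If some u
    in Y has a label different from 2 with x, then G_T is the direct product of
    the dihedral Artin group on x, u and of G_(T - x - u), and k lies in the
    former; in it an element commuting with a nontrivial power of u commutes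
    with u ([dihedral_centralizer]). If there is no such u, then k is a power of
    x; the centralizer in G_(T - x) of a nontrivial power of x is generated by the
    vertices whose label with x is 2 ([centralizer_par]).

    The nontriviality of reduced words, for the splittings and for dihedral
    groups, is proved by letting the group act on the reduced sequences of a
    free product ([reduced_word_notin]). *)

(** * Morphisms, generated subgroups and presentations *)

(** Free reduction, enough for the identities that hold by cancellation alone. *)
Ltac gnorm := rewrite ?(invgM, invgK, invg1, mulgA, mulgK, mulgVK, mulgV, mulVg,
  mul1g, mulg1).

Lemma morph_one (G H : groupType) (f : G -> H) :
  {morph f : x y / x * y} -> f 1 = 1.
Proof. by move=> fM; apply: (@mulgI _ (f 1)); rewrite -fM !mulg1. Qed.

Lemma morph_inv (G H : groupType) (f : G -> H) :
  {morph f : x y / x * y} -> {morph f : x / x^-1}.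
Proof.
move=> fM x; apply: (@mulgI _ (f x)).
by rewrite -fM !mulgV (morph_one fM).
Qed.

Lemma morph_exp (G H : groupType) (f : G -> H) n :
  {morph f : x y / x * y} -> {morph f : x / x ^+ n}.
Proof.
move=> fM x; elim: n => [|n IH]; first by rewrite !expg0 (morph_one fM).
by rewrite !expgS fM IH.
Qed.

Section Lift.
Variables (V : choiceType) (R : set (word V * word V)) (L : groupType).
Variable f : V -> L.

Definition eval_letter (a : V * bool) : L := if a.2 then (f a.1)^-1 else f a.1.
Definition eval_word (w : word V) : L := foldr (fun a x => eval_letter a * x) 1 w.

Lemma eval_cat w1 w2 : eval_word (w1 ++ w2) = eval_word w1 * eval_word w2.
Proof. by elim: w1 => [|a w IH] /=; rewrite ?mul1g // IH mulgA. Qed.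

Hypothesis fR : forall r, R r -> eval_word r.1 = eval_word r.2.

Lemma eval_pres_eq w1 w2 : pres_eq R w1 w2 -> eval_word w1 = eval_word w2.
Proof.
elim=> {w1 w2} [//|//|w1 w2 w3 _ -> _ -> //|w1 w1' w2 w2' _ e1 _ e2|[v []]|//].
- by rewrite !eval_cat e1 e2.
- by rewrite /= mulg1 /eval_letter /= mulVg.
- by rewrite /= mulg1 /eval_letter /= mulgV.
Qed.

Definition pres_lift (g : pres_group R) : L := eval_word (pres_word g).

Lemma pres_lift_class w : pres_lift (pres_class R w) = eval_word w.
Proof. by apply: eval_pres_eq; apply: pres_classK. Qed.

Lemma pres_liftM : {morph pres_lift : x y / x * y}.
Proof.
move=> x y; rewrite -(pres_wordK x) -(pres_wordK y).
by rewrite -[_ * _]/(pres_mul _ _) pres_mulE !pres_lift_class eval_cat.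
Qed.

Lemma pres_lift_gen v : pres_lift (pres_gen R v) = f v.
Proof. by rewrite pres_lift_class /= mulg1. Qed.

End Lift.

Section SubgroupGen.
Variable G : groupType.
Implicit Types (A P : set G).

Lemma subgroupV (H : set G) g : is_subgroup H -> H g -> H g^-1.
Proof. by case=> _ _; apply. Qed.
Lemma subgroupM (H : set G) g h : is_subgroup H -> H g -> H h -> H (g * h).
Proof. by case=> _ HM _; apply: HM. Qed.
Lemma subgroup1 (H : set G) : is_subgroup H -> H 1.
Proof. by case. Qed.
Lemma subgroupVE (H : set G) g : is_subgroup H -> H g^-1 -> H g.
Proof. by move=> Hs /(subgroupV Hs); rewrite invgK. Qed.
Lemma subgroupMl (H : set G) g h : is_subgroup H -> H g -> H (g * h) -> H h.
Proof. by move=> Hs /(subgroupV Hs) Hg /(subgroupM Hs Hg); rewrite mulKg. Qed.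
Lemma subgroupMr (H : set G) g h : is_subgroup H -> H h -> H (g * h) -> H g.
Proof. by move=> Hs /(subgroupV Hs) Hg Hgh; move: (subgroupM Hs Hgh Hg); rewrite mulgK. Qed.

Lemma subgroupX (H : set G) g n : is_subgroup H -> H g -> H (g ^+ n).
Proof.
move=> Hs Hg; elim: n => [|n IH]; first by rewrite expg0; apply: subgroup1.
by rewrite expgS; apply: subgroupM.
Qed.

Lemma subgroup_gen_subgroup A : is_subgroup (subgroup_gen A).
Proof.
split=> [M [[]]//|x y xA yA M MA|x xA M MA].
  by case: (MA) => -[_ MM _] _; apply: MM; [apply: xA|apply: yA].
by case: (MA) => -[_ _ MV] _; apply: MV; apply: xA.
Qed.

Lemma mem_subgroup_gen A x : A x -> subgroup_gen A x.
Proof. by move=> Ax M [_]; apply. Qed.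

Lemma subgroup_gen_ind A P :
  is_subgroup P -> (forall x, A x -> P x) -> forall x, subgroup_gen A x -> P x.
Proof. by move=> Psub AP x; apply; split. Qed.

Lemma subgroup_eq_morph (H : groupType) (f g : G -> H) :
  {morph f : x y / x * y} -> {morph g : x y / x * y} ->
  is_subgroup [set x | f x = g x].
Proof.
move=> fM gM; split=> /= [|x y fx fy|x fx].
- by rewrite (morph_one fM) (morph_one gM).
- by rewrite fM gM fx fy.
- by rewrite (morph_inv fM) (morph_inv gM) fx.
Qed.

Lemma subgroup_preim (H : groupType) (f : G -> H) (P : set H) :
  {morph f : x y / x * y} -> is_subgroup P -> is_subgroup [set x | P (f x)].
Proof.
move=> fM [P1 PM PV]; split=> /= [|x y|x].
- by rewrite (morph_one fM).
- by rewrite fM; apply: PM.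
- by rewrite (morph_inv fM); apply: PV.
Qed.

Lemma subgroup_centraliser (z : G) : is_subgroup [set x | commute z x].
Proof.
split=> /= [|x y|x]; first exact: commute1.
  exact: commuteM.
exact: commuteV.
Qed.

Lemma subgroup_centraliserl (z : G) : is_subgroup (commute^~ z).
Proof.
split=> [|x y xz yz|x xz]; apply/commute_sym; first exact: commute1.
  by apply: commuteM; apply: commute_sym.
exact/commuteV/commute_sym.
Qed.

Lemma subgroup_gen1 (a x : G) : subgroup_gen (eq^~ a) x ->
  exists n, x = a ^+ n \/ x = a ^- n.
Proof.
suff PE : forall y, subgroup_gen (eq^~ a) y -> exists i j, y = a ^+ i * a ^- j.
  move=> /PE[i [j ->]]; case: (leqP j i) => ij.
    by exists (i - j)%N; left; rewrite expgnFr.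
  by exists (j - i)%N; right; rewrite expgnFr ?(ltnW ij) //; gnorm.
apply: subgroup_gen_ind => [|_ ->]; last first.
  by exists 1%N, 0; rewrite expg1 expg0 invg1 mulg1.
split=> [|_ _ [i [j ->]] [k [l ->]]|_ [i [j ->]]].
- by exists 0, 0; rewrite expg0 invg1 mulg1.
- exists (i + k)%N, (j + l)%N; rewrite (addnC j) !expgnDr invgM !mulgA.
  congr (_ * _); rewrite -!mulgA; congr (_ * _).
  by apply/commute_sym/commuteV/commuteX2/commute_refl.
by exists j, i; gnorm.
Qed.

Lemma subgroup_gen_commute (A B : set G) :
  (forall a b, A a -> B b -> commute a b) ->
  forall x y, subgroup_gen A x -> subgroup_gen B y -> commute x y.
Proof.
move=> AB x y Ax By; move: x Ax; apply: subgroup_gen_ind.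
  exact: subgroup_centraliserl.
move=> a Aa; move: y By; apply: subgroup_gen_ind; first exact: subgroup_centraliser.
by move=> v; apply: AB.
Qed.

Lemma subgroup_genU_commute (A B : set G) :
  (forall a b, A a -> B b -> commute a b) ->
  forall x, subgroup_gen (fun g => A g \/ B g) x ->
  exists y z, [/\ subgroup_gen A y, subgroup_gen B z & x = y * z].
Proof.
move=> AB; have sA := subgroup_gen_subgroup A; have sB := subgroup_gen_subgroup B.
have AB' := subgroup_gen_commute AB.
apply: subgroup_gen_ind => [|x [Ax|Bx]].
- split=> [|_ _ [y [z [Ay Bz ->]]] [y' [z' [Ay' Bz' ->]]]|_ [y [z [Ay Bz ->]]]].
  + by exists 1, 1; rewrite mulg1; split=> //; [exact: (subgroup1 sA)|exact: (subgroup1 sB)].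
  + exists (y * y'), (z * z'); split; [exact: (subgroupM sA) | exact: (subgroupM sB) |].
    have zy : z * y' = y' * z by apply/commute_sym/AB'.
    by rewrite -[LHS]mulgA (mulgA z) zy; gnorm.
  + exists y^-1, z^-1; split; [exact: (subgroupV sA) | exact: (subgroupV sB) |].
    by rewrite invgM; apply/commute_sym/AB'; [exact: (subgroupV sA)|exact: (subgroupV sB)].
- by exists x, 1; rewrite mulg1; split=> //; [exact: mem_subgroup_gen|exact: (subgroup1 sB)].
- by exists 1, x; rewrite mul1g; split=> //; [exact: (subgroup1 sA)|exact: mem_subgroup_gen].
Qed.

End SubgroupGen.

Lemma pres_gen_generate (V : choiceType) (R : set (word V * word V))
  (P : set (pres_group R)) :
  is_subgroup P -> (forall v, P (pres_gen R v)) -> forall x, P x.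
Proof.
move=> [P1 PM PV] Pgen x; rewrite -(pres_wordK x).
elim: (pres_word x) => [|[v b] w IH]; first exact: P1.
rewrite -cat1s -pres_mulE; apply: PM IH.
case: b; last exact: Pgen.
rewrite -[[:: _]]/(inv_word [:: (v, false)]) -pres_invE.
by apply: PV; apply: Pgen.
Qed.

(** * Groups of bijections *)

Record bijection (T : Type) := Bijection {
  bij_fun :> T -> T;
  bij_inv : T -> T;
  bij_funK : cancel bij_fun bij_inv;
  bij_invK : cancel bij_inv bij_fun }.

Section BijectionGroup.
Variable T : Type.
Implicit Types f g : bijection T.

Lemma bijectionP f g : f =1 g -> f = g.
Proof.
case: f g => [f f' fK f'K] [g g' gK g'K] /= /funext efg; case: _ / efg gK g'K.
move=> gK g'K; have efg' : f' = g' by apply/funext => x; rewrite -{1}(g'K x) fK.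
by case: _ / efg' gK g'K => gK g'K; congr Bijection; apply: Prop_irrelevance.
Qed.

HB.instance Definition _ := gen_eqMixin (bijection T).
HB.instance Definition _ := gen_choiceMixin (bijection T).

Definition bij_one := @Bijection T id id (fun=> erefl) (fun=> erefl).
Definition bij_mul f g :=
  Bijection (can_comp (@bij_funK _ f) (@bij_funK _ g))
            (can_comp (@bij_invK _ g) (@bij_invK _ f)).
Definition bij_invg f := Bijection (@bij_invK _ f) (@bij_funK _ f).

Lemma bij_mulA : associative bij_mul.
Proof. by move=> f g h; apply: bijectionP. Qed.
Lemma bij_mul1g : left_id bij_one bij_mul.
Proof. by move=> f; apply: bijectionP. Qed.
Lemma bij_mulg1 : right_id bij_one bij_mul.
Proof. by move=> f; apply: bijectionP. Qed.
Lemma bij_mulVg : left_inverse bij_one bij_invg bij_mul.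
Proof. by move=> f; apply: bijectionP => x /=; rewrite bij_funK. Qed.
Lemma bij_mulgV : right_inverse bij_one bij_invg bij_mul.
Proof. by move=> f; apply: bijectionP => x /=; rewrite bij_invK. Qed.

HB.instance Definition _ := isGroup.Build (bijection T)
  bij_mulA bij_mul1g bij_mulg1 bij_mulVg bij_mulgV.

Lemma bijM f g x : (f * g) x = f (g x). Proof. by []. Qed.
Lemma bij1 x : (1 : bijection T) x = x. Proof. by []. Qed.

End BijectionGroup.

Section ActionHom.
Variables (G : groupType) (T : Type) (act : G -> T -> T).
Hypotheses (act1 : act 1 =1 id)
  (actM : forall g h x, act (g * h) x = act g (act h x)).

Definition act_bij (g : G) : bijection T.
Proof.
by exists (act g) (act g^-1) => x; rewrite -actM ?mulgV ?mulVg act1.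
Defined.

Lemma act_bijM : {morph act_bij : g h / g * h}.
Proof. by move=> g h; apply: bijectionP => x /=; rewrite actM. Qed.
End ActionHom.

(** * Reduced sequences of a free product *)

Definition alternating (t : seq bool) : bool := sorted (fun b c => b != c) t.

Lemma alternating_rev t : alternating (rev t) = alternating t.
Proof. by rewrite /alternating rev_sorted; apply: eq_sorted => b c; rewrite eq_sym. Qed.

Lemma alternating_cat t1 b c t2 :
  alternating (rcons t1 b ++ c :: t2) =
  [&& alternating (rcons t1 b), b != c & alternating (c :: t2)].
Proof.
rewrite /alternating; case: t1 => [|d t1] //=.
by rewrite cat_path last_rcons /=.
Qed.

Lemma alternating_rcons t1 b c :
  alternating (rcons (rcons t1 b) c) = alternating (rcons t1 b) && (b != c).
Proof. by rewrite -[rcons _ c]cats1 alternating_cat andbT. Qed.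

Lemma alternating_cons b c t :
  alternating (b :: c :: t) = (b != c) && alternating (c :: t).
Proof. by []. Qed.

Lemma alternating_cat1 s1 b s2 :
  alternating (s1 ++ b :: s2) = alternating (rcons s1 b) && alternating (b :: s2).
Proof.
case: (lastP s1) => [|s c]; first by [].
by rewrite alternating_cat alternating_rcons andbA.
Qed.

(** The form in which the middle part of a factorisation is used: what starts and
    ends on the side opposite to b can be surrounded by letters of side b. *)
Lemma alternating_around b t : alternating (b :: rcons t b) ->
  [/\ alternating (b :: t), alternating (rcons t b),
      alternating (b :: rev t) & alternating (rcons (rev t) b)].
Proof.
move=> t_alt.
have bt : alternating (b :: t).
  by case: (lastP t) t_alt => [//|t' c]; rewrite -!rcons_cons alternating_rcons => /andP[].
have tb : alternating (rcons t b) by apply: path_sorted t_alt.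
split=> //; first by rewrite -rev_rcons alternating_rev.
by rewrite -rev_cons alternating_rev.
Qed.

Lemma palindrome_rev t d : rev (t ++ d :: rev t) = t ++ d :: rev t :> seq bool.
Proof. by rewrite rev_cat rev_cons revK -cats1 -catA. Qed.

(** The sides met along a conjugate w g w^-1, where w has sides t and g has side d. *)
Lemma alternating_palindrome b t d : alternating (rcons (b :: t) d) ->
  [/\ alternating (t ++ d :: rev t), alternating (b :: t ++ d :: rev t)
    & alternating (rcons (t ++ d :: rev t) b)].
Proof.
move=> btd; have bT : alternating (b :: t ++ d :: rev t).
  rewrite -cat_cons alternating_cat1 btd andTb -alternating_rev rev_cons revK.
  exact: path_sorted btd.
split=> //; first exact: path_sorted bT.
by rewrite -alternating_rev rev_rcons palindrome_rev.
Qed.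

(** The sequences of nontrivial elements of K with alternating sides are the
    elements of the free product of two copies of K; each copy acts on them by
    left multiplication. *)
Section FreeProduct.
Variable K : groupType.
Implicit Types (b : bool) (k : K) (s : seq (bool * K)).

Definition starts b s := if s is (c, _) :: _ then c == b else false.

Definition fp_reduced s :=
  all (fun l => l.2 != 1) s && alternating (unzip1 s).

Definition first_in b s := if s is (c, k) :: _ then if c == b then k else 1 else 1.
Definition rest_of b s :=
  if s is (c, k) :: s' then if c == b then s' else s else s.
Definition fp_cons b k s := if k == 1 then s else (b, k) :: s.

(** A reduced sequence is a first syllable of side b, possibly 1, followed by a
    sequence that does not start on side b; multiplication acts on the first
    syllable. This makes multiplicativity immediate. *)
Definition push b k s := fp_cons b (k * first_in b s) (rest_of b s).

Lemma fp_reduced_cons b k s :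
  fp_reduced ((b, k) :: s) = [&& k != 1, ~~ starts b s & fp_reduced s].
Proof.
rewrite /fp_reduced /alternating /=; case: s => [|[c g] s] /=.
  by rewrite andbT.
by rewrite (eq_sym b c) /=; case: (k == 1); case: (c == b); case: (g == 1);
  rewrite //= ?andbF.
Qed.

Lemma fp_cons_reduced b k s :
  ~~ starts b s -> fp_reduced s -> fp_reduced (fp_cons b k s).
Proof.
rewrite /fp_cons; have [//|k1] := eqVneq k 1.
by rewrite fp_reduced_cons k1 => -> ->.
Qed.

Lemma rest_of_reduced b s :
  fp_reduced s -> ~~ starts b (rest_of b s) /\ fp_reduced (rest_of b s).
Proof.
case: s => [|[c k] s] //= sr.
have [cb|cb] := eqVneq c b; last by rewrite /= cb.
by move: sr; rewrite cb fp_reduced_cons => /and3P[].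
Qed.

Lemma first_in_cons b k s : ~~ starts b s -> first_in b (fp_cons b k s) = k.
Proof.
rewrite /fp_cons; have [->|k1] := eqVneq k 1; last by rewrite /= eqxx.
by case: s => [|[c g] s] //= /negPf ->.
Qed.

Lemma rest_of_cons b k s : ~~ starts b s -> rest_of b (fp_cons b k s) = s.
Proof.
rewrite /fp_cons; have [_|_] := eqVneq k 1; last by rewrite /= eqxx.
by case: s => [|[c g] s] //= /negPf ->.
Qed.

Lemma push_reduced b k s : fp_reduced s -> fp_reduced (push b k s).
Proof. by move=> /(@rest_of_reduced b)[]; apply: fp_cons_reduced. Qed.

Lemma push1 b s : fp_reduced s -> push b 1 s = s.
Proof.
rewrite /push mul1g; case: s => [|[c g] s] /=; first by rewrite /fp_cons eqxx.
rewrite fp_reduced_cons => /andP[g1 _].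
by have [->|cb] := eqVneq c b; rewrite /fp_cons ?eqxx // (negPf g1).
Qed.

Lemma pushM b k k' s :
  fp_reduced s -> push b (k * k') s = push b k (push b k' s).
Proof.
move=> /(@rest_of_reduced b)[Ns _].
by rewrite [in RHS]/push first_in_cons // rest_of_cons // mulgA.
Qed.

Lemma push_nonstart b k s : ~~ starts b s -> k != 1 -> push b k s = (b, k) :: s.
Proof.
move=> Ns k1; rewrite /push /fp_cons.
case: s Ns => [|[c g] s] /=; first by rewrite mulg1 (negPf k1).
by move=> /negPf ->; rewrite mulg1 (negPf k1).
Qed.

End FreeProduct.

(** Two morphisms val and ret from G to K let G act on the reduced sequences for
    each side b: ret acts on all syllables by conjugation, and val / ret by
    multiplication on side b. If val is the identity and ret a retraction of G
    onto a subgroup C, the sequences with syllables in ker ret are the cosets of C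
    in the amalgam over C of two copies of G, and this is left multiplication by
    an element of the copy b. If ret is trivial, it is left multiplication by val
    in a free product. *)
Section TwistedAction.
Variables (G K : groupType) (val ret : G -> K).
Hypotheses (valM : {morph val : x y / x * y}) (retM : {morph ret : x y / x * y}).
Implicit Types (b : bool) (g : G) (s : seq (bool * K)).

Definition conj_letter (r : K) (l : bool * K) := (l.1, r * l.2 * r^-1).

Definition twist b g s := push b (val g * (ret g)^-1) (map (conj_letter (ret g)) s).

Lemma conj_letter_reduced r s :
  fp_reduced (map (conj_letter r) s) = fp_reduced s.
Proof.
rewrite /fp_reduced /unzip1 -map_comp; congr (_ && _).
rewrite all_map; apply: eq_all => -[c k] /=; congr (~~ _).
by rewrite -{1}(mulgV r) divg_eq mulgVK -{2}(mulg1 r) (inj_eq (@mulgI _ r)).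
Qed.

Lemma twist_reduced b g s : fp_reduced s -> fp_reduced (twist b g s).
Proof. by move=> sr; apply: push_reduced; rewrite conj_letter_reduced. Qed.

Lemma map_conj_letter_push r b k s :
  map (conj_letter r) (push b k s) = push b (r * k * r^-1) (map (conj_letter r) s).
Proof.
have conj1 (h : K) : (r * h * r^-1 == 1) = (h == 1).
  by rewrite -{1}(mulgV r) divg_eq mulgVK -{2}(mulg1 r) (inj_eq (@mulgI _ r)).
have consE (h : K) (t : seq (bool * K)) :
    map (conj_letter r) (fp_cons b h t) =
    fp_cons b (r * h * r^-1) (map (conj_letter r) t).
  by rewrite /fp_cons conj1; case: (h == 1).
rewrite /push consE; congr fp_cons.
  case: s => [|[c h] s] /=; first by gnorm.
  by case: (c == b); gnorm.
by case: s => [|[c h] s] //=; case: (c == b).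
Qed.

Lemma twistM b g h s :
  fp_reduced s -> twist b (g * h) s = twist b g (twist b h s).
Proof.
move=> sr; rewrite /twist map_conj_letter_push -map_comp -pushM; last first.
  suff -> : map (conj_letter (ret g) \o conj_letter (ret h)) s =
            map (conj_letter (ret g)) (map (conj_letter (ret h)) s).
    by rewrite !conj_letter_reduced.
  by rewrite map_comp.
congr push; first by rewrite valM retM; gnorm.
by apply: eq_map => -[c k]; rewrite /conj_letter /= retM; gnorm.
Qed.

Lemma twist1 b s : fp_reduced s -> twist b 1 s = s.
Proof.
move=> sr; rewrite /twist (morph_one valM) (morph_one retM) invg1 mulg1.
rewrite push1 ?conj_letter_reduced // map_id_in // => -[c k] _.
by rewrite /conj_letter /= invg1 mulg1 mul1g.
Qed.

Definition fp_elt := {s : seq (bool * K) | fp_reduced s}.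
Definition twist_elt b g (x : fp_elt) : fp_elt :=
  exist _ (twist b g (sval x)) (twist_reduced b g (svalP x)).

Lemma twist_elt1 b : twist_elt b 1 =1 id.
Proof. by move=> x; apply: val_inj => /=; rewrite twist1 //; exact: (svalP x). Qed.

Lemma twist_eltM b g h x :
  twist_elt b (g * h) x = twist_elt b g (twist_elt b h x).
Proof. by apply: val_inj => /=; rewrite twistM //; exact: (svalP x). Qed.

Definition twist_bij b : G -> bijection fp_elt :=
  act_bij (twist_elt1 b) (twist_eltM b).

Lemma twist_bijM b : {morph twist_bij b : g h / g * h}.
Proof. exact: act_bijM. Qed.

(** The actions of the two sides can be glued along the elements with val = ret. *)
Lemma twist_bij_base b c g : val g = ret g -> twist_bij b g = twist_bij c g.
Proof.
move=> vr; apply: bijectionP => x; apply: val_inj; rewrite /= /twist vr mulgV.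
by rewrite !push1 ?conj_letter_reduced //; exact: (svalP x).
Qed.

End TwistedAction.

Lemma twist_bij_triv (G K : groupType) (val ret : G -> K)
  (valM : {morph val : x y / x * y}) (retM : {morph ret : x y / x * y}) b g :
  val g = 1 -> ret g = 1 -> twist_bij valM retM b g = 1.
Proof.
move=> v1 r1; apply: bijectionP => x; apply: val_inj; rewrite /= /twist v1 r1.
rewrite mulgV push1 ?conj_letter_reduced ?(svalP x) //.
by rewrite map_id_in // => -[c k] _; rewrite /conj_letter /= invg1 mulg1 mul1g.
Qed.

(** * Reduced words *)

Section AmalgamWords.
Variables (G : groupType).
Implicit Types (g h : G) (s t : seq (bool * G)).

Definition wprod s : G := foldr (fun l x => l.2 * x) 1 s.
Definition winv s := rev (map (fun l : bool * G => (l.1, l.2^-1)) s).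

Lemma wprod_cat s t : wprod (s ++ t) = wprod s * wprod t.
Proof. by elim: s => [|l s IH] /=; rewrite ?mul1g // IH mulgA. Qed.

Lemma wprod_inv s : wprod (winv s) = (wprod s)^-1.
Proof.
elim: s => [|l s IH] /=; first by rewrite invg1.
rewrite /winv /= rev_cons -cats1 wprod_cat -/(winv s) IH /= mulg1.
by rewrite invgM.
Qed.

Definition reduced_word (A : bool -> set G) (C : set G) s : Prop :=
  (forall l, l \in s -> A l.1 l.2 /\ ~ C l.2) /\ alternating (unzip1 s).

End AmalgamWords.

(** An action of G that restricts on A b to the twisted action of side b detects
    reduced words: letters outside C add a syllable on their side to a sequence
    that starts on the other side, whereas C fixes the empty sequence. *)
Section PingPong.
Variables (G K : groupType) (val ret : G -> K).
Hypotheses (valM : {morph val : x y / x * y}) (retM : {morph ret : x y / x * y}).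
Variable Phi : G -> bijection (fp_elt K).
Hypothesis PhiM : {morph Phi : x y / x * y}.
Variables (A : bool -> set G) (C : set G).
Hypotheses (PhiA : forall b g, A b g -> Phi g = twist_bij valM retM b g)
  (AC : forall b g, A b g -> val g = ret g -> C g)
  (CA : forall g, C g -> A false g) (Cval : forall g, C g -> val g = ret g).

Definition fp_nil : fp_elt K := exist _ [::] isT.

Lemma reduced_word_acts s :
  reduced_word A C s -> unzip1 (sval (Phi (wprod s) fp_nil)) = unzip1 s.
Proof.
elim: s => [|[b g] s IH] [sA s_alt] /=.
  by rewrite (morph_one PhiM).
have {}IH := IH (conj (fun l ls => sA l (mem_behead ls)) (path_sorted s_alt)).
have [Ag nCg] := sA _ (mem_head _ _).
rewrite PhiM bijM (PhiA Ag) /=.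
move: (Phi _ _) IH => x IH.
rewrite /twist push_nonstart /=.
- by congr (_ :: _); rewrite -[RHS]IH /unzip1 -map_comp.
- case: s IH s_alt {sA} => [|[c h] s] /=.
    by case: (sval x).
  case: (sval x) => [|[d k] ?] //= [-> _] /andP[].
  by rewrite eq_sym.
- apply/eqP => vr; apply: nCg; apply: (AC Ag).
  by rewrite -[LHS](mulgVK (ret g)) vr mul1g.
Qed.

Lemma reduced_word_notin s : reduced_word A C s -> C (wprod s) -> s = [::].
Proof.
move=> sr Cs; have /(congr1 size) := reduced_word_acts sr.
rewrite (PhiA (CA Cs)) /= /twist (Cval Cs) mulgV /= push1 //= !size_map.
by case: (s).
Qed.

End PingPong.

(** Normal forms for products of elements of two subgroups A b. The subgroup C has
    the same trace on both; it is kept when the A b are replaced by smaller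
    subgroups, so that words reduced for the latter stay reduced for the former. *)
Section WordLemmas.
Variables (G : groupType) (A : bool -> set G) (C : set G).
Hypotheses (Asub : forall b, is_subgroup (A b)) (Csub : is_subgroup C).
Implicit Types (g h : G) (s t : seq (bool * G)).

Lemma reduced_word_nil : reduced_word A C [::].
Proof. by split. Qed.

Lemma reduced_word_cons b g s :
  reduced_word A C ((b, g) :: s) <->
  [/\ A b g, ~ C g, alternating (b :: unzip1 s) & reduced_word A C s].
Proof.
split=> [[sA s_alt]|[Ag nCg s_alt [sA _]]].
  have [Ag nCg] := sA _ (mem_head _ _); split=> //.
  by split; [move=> l ls; apply: sA; apply: mem_behead | apply: path_sorted s_alt].
by split=> // l; rewrite inE => /predU1P[->|/sA].
Qed.

Lemma reduced_word_cat s t :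
  reduced_word A C s -> reduced_word A C t -> alternating (unzip1 (s ++ t)) ->
  reduced_word A C (s ++ t).
Proof.
by move=> [sA _] [tA _]; split=> // l; rewrite mem_cat => /orP[/sA|/tA].
Qed.

Lemma reduced_word_catl s t : reduced_word A C (s ++ t) -> reduced_word A C s.
Proof.
move=> [stA]; rewrite /unzip1 map_cat /alternating => st_alt; split.
  by move=> l ls; apply: stA; rewrite mem_cat ls.
by move: st_alt; rewrite /alternating; case: (s) => [|l s'] //=; rewrite cat_path => /andP[].
Qed.

Lemma unzip1_winv s : unzip1 (winv s) = rev (unzip1 s).
Proof. by rewrite /winv /unzip1 map_rev -map_comp. Qed.

Lemma reduced_word_inv s : reduced_word A C s -> reduced_word A C (winv s).
Proof.
move=> [sA s_alt]; split; last by rewrite unzip1_winv alternating_rev.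
move=> l; rewrite mem_rev => /mapP[l' /sA[Al nCl] ->] /=.
by split; [apply: subgroupV | move/(subgroupVE Csub)].
Qed.

Hypothesis AC : forall b g, A b g -> C g -> A (~~ b) g.

Definition in_base g := C g /\ forall b, A b g.

Lemma in_baseI b g : A b g -> C g -> in_base g.
Proof.
move=> Ag Cg; split=> // c; case: (eqVneq c b) => [->//|cb].
by have -> : c = ~~ b; [case: (c) (b) cb => -[] | apply: AC].
Qed.

Definition has_form g :=
  exists s c, [/\ reduced_word A C s, in_base c & g = wprod s * c].

(** Multiplying by a letter of side b either adds a letter, or merges with the
    first letter, or is absorbed in the base; a product that falls into the base is
    absorbed by the next letter. *)
Lemma has_form_mull b a g : A b a -> has_form g -> has_form (a * g).
Proof.
move=> Aa [s [c [sr cB ->]]]; rewrite mulgA; case: s sr => [|[d h] s] sr /=.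
  rewrite mulg1; have [Ca|nCa] := pselect (C a).
    exists [::], (a * c); split; [exact: reduced_word_nil| |by rewrite mul1g].
    by split; [apply: subgroupM => //; case: cB | move=> e; apply: subgroupM => //;
       [case: (in_baseI Aa Ca)|case: cB]].
  exists [:: (b, a)], c; split=> //; last by rewrite /= mulg1.
  by apply/reduced_word_cons; split=> //; apply: reduced_word_nil.
have /reduced_word_cons[Ah nCh s_alt sr'] := sr.
have [Ca|nCa] := pselect (C a).
  have Ba := in_baseI Aa Ca.
  exists ((d, a * h) :: s), c; split=> //; last by rewrite /= !mulgA.
  apply/reduced_word_cons; split=> //; first by apply: subgroupM => //; case: Ba.
  by move=> /(subgroupMl Csub Ca).
have [edb|db] := eqVneq d b; last first.
  exists ((b, a) :: (d, h) :: s), c; split=> //.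
  by apply/reduced_word_cons; split=> //=; rewrite eq_sym db.
subst d; have Aah : A b (a * h) by apply: subgroupM.
have [Cah|nCah] := pselect (C (a * h)); last first.
  exists ((b, a * h) :: s), c; split=> //; last by rewrite /= !mulgA.
  by apply/reduced_word_cons.
have Bah := in_baseI Aah Cah.
case: s s_alt sr' {sr} => [|[e k] s] s_alt sr'.
  exists [::], (a * h * c); split=> //=; last by gnorm.
  by split; [apply: subgroupM => //; case: cB | move=> e; apply: subgroupM => //;
       [case: Bah|case: cB]].
have /reduced_word_cons[Ak nCk s_alt' sr''] := sr'.
exists ((e, a * h * k) :: s), c; split=> //; last by rewrite /= !mulgA.
apply/reduced_word_cons; split=> //; first by apply: subgroupM => //; case: Bah.
by move=> /(subgroupMl Csub Cah).
Qed.

Lemma has_form1 : has_form 1.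
Proof.
exists [::], 1; split; [exact: reduced_word_nil| |by rewrite mulg1].
by split=> *; apply: subgroup1.
Qed.

Lemma has_form_gen (D : set G) g :
  (forall x, D x -> exists b, A b x) -> subgroup_gen D g -> has_form g.
Proof.
move=> DA Dg; rewrite -[g]mulg1.
suff [] : (forall h, has_form h -> has_form (g * h)) /\
          (forall h, has_form h -> has_form (g^-1 * h)).
  by move=> /(_ 1 has_form1).
pose P x := (forall h, has_form h -> has_form (x * h)) /\
            (forall h, has_form h -> has_form (x^-1 * h)).
apply: (@subgroup_gen_ind _ D P) Dg; last first.
  by move=> x /DA[b Ax]; split=> h; apply: (@has_form_mull b) => //; apply: subgroupV.
split=> [|x y [x1 x2] [y1 y2]|x [x1 x2]].
- by split=> h; rewrite ?invg1 mul1g.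
- by split=> h hh; rewrite ?invgM -mulgA; [apply/x1/y1|apply/y2/x2].
- by rewrite /P invgK.
Qed.

(** Moving the extremal letters of side b, and the base part, into p and q leaves a
    middle word that is empty or starts and ends on the other side. *)
Lemma has_form_split b g : has_form g ->
  exists p t q, [/\ A b p, A b q, g = p * wprod t * q, reduced_word A C t
    & t = [::] \/ alternating (b :: rcons (unzip1 t) b)].
Proof.
move=> [s [c [sr [Cc Ac] ->]]].
have [p [s1 [Ap sr1 -> s1_alt]]] : exists p s1,
    [/\ A b p, reduced_word A C s1, wprod s = p * wprod s1
      & s1 = [::] \/ alternating (b :: unzip1 s1)].
  case: s sr => [|[d h] s] sr.
    by exists 1, [::]; split; [apply: subgroup1 | | rewrite mulg1 | left].
  have [edb|db] := eqVneq d b; last first.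
    exists 1, ((d, h) :: s); split; [exact: subgroup1| by [] | by rewrite mul1g|right].
    by case: sr => _ s_alt; rewrite [unzip1 _]/= alternating_cons eq_sym db.
  have /reduced_word_cons[Ah nCh s_alt sr'] := sr.
  by exists h, s; split=> //; rewrite -edb //; right.
case: (lastP s1) sr1 s1_alt => [|s2 [d h]] sr1 s1_alt.
  by exists p, [::], c; split=> //; left.
have [edb|db] := eqVneq d b; last first.
  exists p, (rcons s2 (d, h)), c; split=> //; right.
  case: s1_alt => [|s1_alt]; first by case: (s2).
  move: s1_alt; rewrite /unzip1 map_rcons -!rcons_cons alternating_rcons => ->.
  by rewrite /= db.
exists p, s2, (h * c); split=> //.
- apply: subgroupM => //; rewrite -edb.
  by case: sr1 => /(_ (d, h)); rewrite mem_rcons mem_head => /(_ isT)[].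
- by rewrite -cats1 wprod_cat /=; gnorm.
- by apply: (@reduced_word_catl _ [:: (d, h)]); rewrite cats1.
case: s1_alt => [|s1_alt]; first by case: (s2).
case: (s2) s1_alt => [|l s3]; first by left.
by move=> s1_alt; right; move: s1_alt; rewrite -edb /unzip1 map_rcons.
Qed.

End WordLemmas.

(** * Even Artin groups: retractions and parabolic subgroups *)

Lemma eval_alt_even (V : choiceType) (L : groupType) (f : V -> L) u v q :
  eval_word f (alt_word u v q.*2) = (f u * f v) ^+ q.
Proof.
by elim: q => [|q IH] //; rewrite doubleS expgS -IH /= mulgA.
Qed.

Lemma pres_class_eval (V : choiceType) (R : set (word V * word V)) w :
  pres_class R w = eval_word (@pres_gen V R) w.
Proof.
elim: w => [|[v b] w IH] //=; rewrite -IH -cat1s -pres_mulE; congr (_ * _).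
by case: b => //; rewrite /eval_letter /= -[RHS]/(pres_invg _) pres_invE.
Qed.

Section ParabolicBasics.
Variable Gamma : artin_graph.
Notation V := (vertex Gamma).
Notation G := (artin_group Gamma).
Notation gen := (@artin_gen Gamma).
Notation par := (@standard_parabolic Gamma).
Implicit Types (S T : {set V}) (P Q : set G) (g x : G) (u v : V).

(** Since labels are even, the relation of an edge reads (u v)^h = (v u)^h with
    this exponent h. *)
Definition half_label u v := (label [set u; v])./2.

Lemma half_labelC u v : half_label u v = half_label v u.
Proof. by rewrite /half_label finset.setUC. Qed.

Lemma parabolicE P : parabolic P <->
  exists g S, forall x, P x <-> par S (g^-1 * x * g).
Proof.
split=> -[g [S PE]]; exists g, S.
  move=> x; rewrite PE; split=> [[y Sy <-]|Sx]; first by gnorm.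
  by exists (g^-1 * x * g) => //; gnorm.
rewrite predeqE => x; rewrite PE; split=> [Sx|[y Sy <-]].
  by exists (g^-1 * x * g) => //; gnorm.
by gnorm.
Qed.

Lemma parabolic_ext P Q : (forall x, P x <-> Q x) -> parabolic P -> parabolic Q.
Proof. by move=> PQ; have -> // : P = Q by rewrite predeqE. Qed.

Definition conj_set g P : set G := fun x => P (g^-1 * x * g).

Lemma parabolic_conj g P : parabolic P -> parabolic (conj_set g P).
Proof.
move=> /parabolicE[h [S PE]]; apply/parabolicE; exists (g * h), S => x.
by rewrite /conj_set PE; gnorm.
Qed.

Lemma parabolic_conjE g P : parabolic (conj_set g P) -> parabolic P.
Proof.
move=> /(parabolic_conj g^-1); apply: parabolic_ext => x.
by rewrite /conj_set; gnorm.
Qed.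

Lemma par_sub S : is_subgroup (par S).
Proof. exact: subgroup_gen_subgroup. Qed.

Lemma par1 S : par S 1.
Proof. exact: subgroup1 (par_sub S). Qed.
Lemma parM S x y : par S x -> par S y -> par S (x * y).
Proof. exact: subgroupM (par_sub S). Qed.
Lemma parV S x : par S x -> par S x^-1.
Proof. exact: subgroupV (par_sub S). Qed.

Lemma parabolic_sub P : parabolic P -> is_subgroup P.
Proof.
move=> /parabolicE[g [S PE]]; have [p1 pM pV] := par_sub S; split.
- by apply/PE; gnorm.
- move=> x y /PE Px /PE Py; apply/PE; move: (pM _ _ Px Py); by gnorm.
- by move=> x /PE /pV; rewrite PE; gnorm.
Qed.

Lemma par_gen S v : v \in S -> par S (gen v).
Proof. by move=> vS; apply: mem_subgroup_gen; exists v. Qed.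

Lemma par_ind S P : is_subgroup P -> (forall v, v \in S -> P (gen v)) ->
  forall x, par S x -> P x.
Proof.
by move=> Psub Pgen; apply: subgroup_gen_ind => // _ [v vS <-]; apply: Pgen.
Qed.

Lemma par_parabolic S : parabolic (par S).
Proof. by apply/parabolicE; exists 1, S => x; rewrite invg1 mul1g mulg1. Qed.

Lemma par_mono S T : S \subset T -> forall x, par S x -> par T x.
Proof.
move=> /fintype.subsetP ST; apply: par_ind; first exact: par_sub.
by move=> v /ST; apply: par_gen.
Qed.

Lemma par_full x : par [set: V] x.
Proof.
apply: (@pres_gen_generate _ _ (par [set: V])); first exact: par_sub.
by move=> v; apply: par_gen; rewrite inE.
Qed.

Lemma par_set0 x : par finset.set0 x -> x = 1.
Proof.
apply: (@par_ind _ (eq^~ 1)) => [|v]; last by rewrite inE.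
by split=> //= [y z -> ->|y ->]; rewrite ?mulg1 ?invg1.
Qed.

Lemma par_commute S T : (forall u v, u \in S -> v \in T -> commute (gen u) (gen v)) ->
  forall x y, par S x -> par T y -> commute x y.
Proof.
by move=> ST; apply: subgroup_gen_commute => _ _ [u uS <-] [v vT <-]; apply: ST.
Qed.

Lemma par_setU_commute S T :
  (forall u v, u \in S -> v \in T -> commute (gen u) (gen v)) ->
  forall x, par (S :|: T) x -> exists y z, [/\ par S y, par T z & x = y * z].
Proof.
move=> ST x STx; apply: subgroup_genU_commute.
  by move=> _ _ [u uS <-] [v vT <-]; apply: ST.
move: x STx; apply: par_ind; first exact: subgroup_gen_subgroup.
move=> v; rewrite finset.in_setU => vST; apply: mem_subgroup_gen.
by case/orP: vST => vST; [left | right]; exists v.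
Qed.

Lemma par_set1 v x : par [set v] x <-> subgroup_gen (eq^~ (gen v)) x.
Proof.
split; last first.
  move: x; apply: subgroup_gen_ind; first exact: par_sub.
  by move=> _ ->; apply: par_gen; rewrite inE.
move: x; apply: par_ind; first exact: subgroup_gen_subgroup.
by move=> w /finset.set1P ->; apply: mem_subgroup_gen.
Qed.

Lemma edge_neq v w : [set v; w] \in edges Gamma -> v != w.
Proof. by move=> /edge_card; rewrite cards2; case: (v == w). Qed.

Lemma artin_rel u v : [set u; v] \in edges Gamma -> even_graph Gamma ->
  (gen u * gen v) ^+ half_label u v = (gen v * gen u) ^+ half_label u v.
Proof.
move=> uv /(_ _ uv) ev.
rewrite -!eval_alt_even -!pres_class_eval; apply/pres_classP.
have -> : (half_label u v).*2 = label [set u; v].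
  by rewrite -[RHS]odd_double_half (negPf ev) add0n.
by apply: (@pres_rel _ _ (_, _)); exists u, v; split.
Qed.

Hypothesis Gamma_even : even_graph Gamma.

Lemma commute_label2 u v :
  [set u; v] \in edges Gamma -> label [set u; v] = 2 -> commute (gen u) (gen v).
Proof.
by move=> uv m2; have := artin_rel uv Gamma_even; rewrite /half_label m2 !expg1.
Qed.

Section Hom.
Variables (L : groupType) (f : V -> L).
Hypothesis fR : forall u v, [set u; v] \in edges Gamma ->
  (f u * f v) ^+ half_label u v = (f v * f u) ^+ half_label u v.

Lemma hom_rel r : @artin_rels Gamma r -> eval_word f r.1 = eval_word f r.2.
Proof.
move=> [u [v [uv ->]]] /=.
have -> : label [set u; v] = (half_label u v).*2.
  by rewrite -[LHS]odd_double_half (negPf (Gamma_even uv)) add0n.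
by rewrite !eval_alt_even fR.
Qed.

Definition artin_hom : G -> L := pres_lift f.
Lemma artin_homM : {morph artin_hom : x y / x * y}.
Proof. exact: (pres_liftM hom_rel). Qed.
Lemma artin_hom_gen v : artin_hom (gen v) = f v.
Proof. exact: (pres_lift_gen hom_rel). Qed.
End Hom.

Definition retract_gen S v : G := if v \in S then gen v else 1.

(** Evenness is essential: with one of u, v sent to 1, both sides of the relation
    become the same power h of the other generator. *)
Lemma retract_gen_rel S u v : [set u; v] \in edges Gamma ->
  (retract_gen S u * retract_gen S v) ^+ half_label u v =
  (retract_gen S v * retract_gen S u) ^+ half_label u v.
Proof.
move=> uv; rewrite /retract_gen; case: (u \in S); case: (v \in S);
  rewrite ?mul1g ?mulg1 //; exact: artin_rel.
Qed.

Definition retract S : G -> G := artin_hom (retract_gen S).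

Lemma retractM S : {morph retract S : x y / x * y}.
Proof. exact/artin_homM/retract_gen_rel. Qed.
Lemma retractV S : {morph retract S : x / x^-1}.
Proof. exact/morph_inv/retractM. Qed.
Lemma retract1 S : retract S 1 = 1.
Proof. exact/morph_one/retractM. Qed.
Lemma retract_genE S v : retract S (gen v) = if v \in S then gen v else 1.
Proof. exact/artin_hom_gen/retract_gen_rel. Qed.

Lemma retract_id S x : par S x -> retract S x = x.
Proof.
move: x; apply: par_ind.
  exact: (@subgroup_eq_morph _ _ (retract S) id (retractM S) (fun _ _ => erefl)).
by move=> v vS; rewrite retract_genE vS.
Qed.

Lemma retract_par S T x : par T x -> par (S :&: T) (retract S x).
Proof.
move: x; apply: par_ind.
  exact: (subgroup_preim (retractM S) (par_sub _)).
move=> v vT; rewrite retract_genE; case: ifP => vS; last exact: par1.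
by apply: par_gen; rewrite inE vS.
Qed.

Lemma retract_in S x : par S (retract S x).
Proof. by have := @retract_par S _ _ (par_full x); rewrite finset.setIT. Qed.

Lemma parI S T x : par S x -> par T x -> par (S :&: T) x.
Proof. by move=> /retract_id {2}<-; apply: retract_par. Qed.

Lemma retract_comp S T x : retract S (retract T x) = retract (S :&: T) x.
Proof.
have := par_full x; move: x; apply: par_ind.
  apply: (@subgroup_eq_morph _ _ (retract S \o retract T)) => x y /=;
  by rewrite !retractM.
move=> v _; rewrite !retract_genE inE; case: (v \in T); rewrite ?andbT ?andbF.
  by rewrite retract_genE.
exact: retract1.
Qed.

(** Retracting the conjugating element onto T does not change a subgroup on which
    the retraction is the identity. *)
Lemma parabolic_in T P : parabolic P -> (forall x, P x -> par T x) ->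
  exists g S, [/\ par T g, S \subset T & forall x, P x <-> par S (g^-1 * x * g)].
Proof.
move=> /parabolicE[g [S PE]] PT; exists (retract T g), (T :&: S).
split; [exact: retract_in | exact: finset.subsetIl | move=> x; split=> [Px|]].
  rewrite -(retract_id (PT _ Px)) -retractV -!retractM.
  by apply: retract_par; apply/PE.
move=> xS; set y := (X in par _ X) in xS.
have Px' : P (g * y * g^-1).
  by apply/PE; gnorm; apply: par_mono xS; apply: finset.subsetIr.
have := retract_id (PT _ Px').
rewrite (retractM T (g * y)) (retractM T g) retractV.
rewrite (retract_id (par_mono (finset.subsetIl T S) xS)) => yE.
by move: Px'; rewrite -yE /y; gnorm.
Qed.

(** An element of G_S in g G_T g^-1 equals its image under the retraction onto S,
    which lies in the conjugate of G_(S /\ T) by the image of g. *)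
Lemma par_conjI S T g x :
  par S x /\ par T (g^-1 * x * g) <->
  par (S :&: T) ((retract S g)^-1 * x * retract S g) /\ par T (g^-1 * x * g).
Proof.
split=> -[Sx Tx]; split=> //.
  by rewrite -{1}(retract_id Sx) -retractV -!retractM; apply: retract_par.
have Sr := @retract_in S g.
have := par_mono (finset.subsetIl S T) Sx.
move=> /(subgroupMr (par_sub S) Sr).
by apply: subgroupMl; [exact: par_sub | exact: parV].
Qed.
End ParabolicBasics.

Arguments par1 {Gamma S}.
Arguments parM {Gamma S x y}.
Arguments parV {Gamma S x}.
Arguments retract_in {Gamma} Gamma_even S x.

(** * The splitting along two nonadjacent vertices *)

(** The factors are the subgroups on [side false], which omits n, and [side true],
    which omits u; the amalgamated subgroup is that on [base]. *)
Section ArtinAmalgam.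
Variables (Gamma : artin_graph) (Gamma_even : even_graph Gamma).
Notation V := (vertex Gamma).
Notation G := (artin_group Gamma).
Notation gen := (@artin_gen Gamma).
Notation par := (@standard_parabolic Gamma).
Variables (u n : V).
Implicit Types (S T : {set V}) (g x : G) (v w : V) (b : bool) (s : seq (bool * G)).

Definition side b : {set V} := finset.setC [set if b then u else n].
Definition base : {set V} := finset.setC [set u; n].

Lemma base_side b : base \subset side b.
Proof.
by apply/fintype.subsetP => v; rewrite !inE negb_or => /andP[]; case: b.
Qed.

Lemma side_notin S b : (if b then u else n) \notin S :&: side b.
Proof. by rewrite !inE eqxx andbF. Qed.

(** Words with letters in G_S, reduced with respect to the splitting of the whole
    group: subsets S then need no splitting of their own. *)
Definition amalgam_words S := reduced_word (fun b => par (S :&: side b)) (par base).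

Lemma amalgam_words_mono S T s : S \subset T -> amalgam_words S s -> amalgam_words T s.
Proof.
move=> ST [sA s_alt]; split=> // l /sA[Al nCl]; split=> //.
by apply: par_mono Al; apply: finset.setSI.
Qed.

Lemma amalgam_in_sides S b g :
  par (S :&: side b) g -> par base g -> par (S :&: side (~~ b)) g.
Proof.
move=> Sg Bg; apply: par_mono (parI Gamma_even Sg Bg).
apply/fintype.subsetP => v; rewrite !inE negb_or => /andP[/andP[-> _]].
by case: (b) => /= /andP[].
Qed.

Lemma amalgam_wordsT S s : amalgam_words S s ->
  reduced_word (fun b => par (side b)) (par base) s.
Proof.
move=> [sA s_alt]; split=> // l /sA[Al nCl]; split=> //.
by apply: par_mono Al; apply: finset.subsetIr.
Qed.

Lemma in_base_par S c : in_base (fun b => par (S :&: side b)) (par base) c ->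
  par (S :&: base) c.
Proof.
move=> [Bc Sc]; apply: par_mono (parI Gamma_even (Sc true) Bc).
by apply: finset.setSI; apply: finset.subsetIl.
Qed.

Hypothesis un : u != n.

Definition side_of v := v == n.

Lemma side_ofP v : v \in side (side_of v).
Proof.
rewrite !inE /side_of; have [->|vn] := eqVneq v n; first by rewrite eq_sym.
by [].
Qed.

Lemma amalgam_form S g : par S g -> has_form (fun b => par (S :&: side b)) (par base) g.
Proof.
apply: has_form_gen => [b||b x|_ [v vS <-]]; first exact: par_sub.
- exact: par_sub.
- exact: amalgam_in_sides.
exists (side_of v); apply: par_gen.
by rewrite finset.in_setI side_ofP andbT.
Qed.

Hypothesis un_edge : [set u; n] \notin edges Gamma.

Let idM : {morph (@id G) : x y / x * y} := fun _ _ => erefl.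
Let retM := @retractM _ Gamma_even base.
Notation tw := (twist_bij idM retM).

Lemma twist_base b c g : par base g -> tw b g = tw c g.
Proof. by move=> Bg; apply: twist_bij_base; rewrite retract_id. Qed.

(** For the splitting, val is the identity and ret the retraction onto the base. A
    vertex acts through either side that contains it; every relation lives on one
    side because u and n are not adjacent. *)
Definition amalgam_gen v : bijection (fp_elt G) := tw (side_of v) (gen v).

Lemma amalgam_genE b v : v \in side b -> amalgam_gen v = tw b (gen v).
Proof.
move=> vb; rewrite /amalgam_gen; have [-> //|bv] := eqVneq (side_of v) b.
apply: twist_base; apply: par_gen; have := side_ofP v; move: vb bv.
by rewrite !inE negb_or; case: (b); case: (side_of v) => //= -> _ ->.
Qed.

Lemma edge_side v w : [set v; w] \in edges Gamma ->
  exists b, v \in side b /\ w \in side b.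
Proof.
move=> vw; rewrite -[exists b, _]notK => Nvw.
have [vf|vf] := boolP (v \in side false); have [wf|wf] := boolP (w \in side false).
- by case: Nvw; exists false.
- have [vt|vt] := boolP (v \in side true); last first.
    by move: vt wf un_edge; rewrite !inE !negbK => /eqP <- /eqP <-; rewrite vw.
  case: Nvw; exists true; split=> //.
  by move: wf; rewrite !inE negbK => /eqP ->; rewrite eq_sym.
- have [wt|wt] := boolP (w \in side true); last first.
    move: wt vf un_edge; rewrite !inE !negbK => /eqP <- /eqP <-.
    by rewrite finset.setUC vw.
  case: Nvw; exists true; split=> //.
  by move: vf; rewrite !inE negbK => /eqP ->; rewrite eq_sym.
- case: Nvw; exists true.
  by move: vf wf; rewrite !inE !negbK => /eqP -> /eqP ->; rewrite eq_sym.
Qed.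

Lemma twX b g q : tw b (g ^+ q) = tw b g ^+ q.
Proof.
elim: q => [|q IH]; first by rewrite !expg0 (morph_one (twist_bijM _ _ _)).
by rewrite !expgS twist_bijM IH.
Qed.

Lemma amalgam_gen_rel v w : [set v; w] \in edges Gamma ->
  (amalgam_gen v * amalgam_gen w) ^+ half_label v w =
  (amalgam_gen w * amalgam_gen v) ^+ half_label v w.
Proof.
move=> vw; have [b [vb wb]] := edge_side vw.
rewrite (amalgam_genE vb) (amalgam_genE wb) -!twist_bijM -!twX.
by rewrite artin_rel.
Qed.

Definition amalgam_act : G -> bijection (fp_elt G) := artin_hom amalgam_gen.

Lemma amalgam_actM : {morph amalgam_act : x y / x * y}.
Proof. exact/(artin_homM Gamma_even)/amalgam_gen_rel. Qed.

Lemma amalgam_actE b g : par (side b) g -> amalgam_act g = tw b g.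
Proof.
move: g; apply: par_ind.
  exact: subgroup_eq_morph amalgam_actM (twist_bijM _ _ _).
move=> v vb; rewrite -(amalgam_genE vb).
exact: (artin_hom_gen Gamma_even amalgam_gen_rel).
Qed.

Lemma amalgam_notin s : reduced_word (fun b => par (side b)) (par base) s ->
  par base (wprod s) -> s = [::].
Proof.
apply: (@reduced_word_notin _ _ _ _ idM retM _ amalgam_actM).
- by move=> b g; apply: amalgam_actE.
- by move=> b g _ /= ->; apply: retract_in.
- by move=> g; apply: par_mono; apply: base_side.
- by move=> g /(retract_id Gamma_even).
Qed.

(** The word t g t^-1 is reduced, of odd length, and the sides of its extremal
    letters differ from b: an element of side b cannot be equal to it. *)
Lemma conj_word_absurd t b d g y :
  reduced_word (fun b => par (side b)) (par base) t ->
  par (side d) g -> ~ par base g ->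
  alternating (rcons (b :: unzip1 t) d) -> par (side b) y ->
  wprod t * g * (wprod t)^-1 <> y.
Proof.
move=> tr dg nBg t_alt by_ ty.
have [alt1 alt2 alt3] := alternating_palindrome t_alt.
pose W := t ++ (d, g) :: winv t.
have WE : unzip1 W = unzip1 t ++ d :: rev (unzip1 t).
  by rewrite [unzip1 _]map_cat map_cons -/(unzip1 (winv t)) unzip1_winv.
have Wp : wprod W = y by rewrite wprod_cat /= wprod_inv mulgA.
have Wr : reduced_word (fun b => par (side b)) (par base) W.
  apply: reduced_word_cat => //; last by rewrite WE.
  apply/reduced_word_cons; split=> //.
    rewrite unzip1_winv -alternating_rev rev_cons revK.
    exact: path_sorted t_alt.
  exact: (reduced_word_inv (fun b => par_sub (side b)) (par_sub _) tr).
have W0 : W <> [::] by rewrite /W; case: (t).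
have [By|nBy] := pselect (par base y).
  by apply: W0; apply: (amalgam_notin Wr); rewrite Wp.
have Wr' : reduced_word (fun b => par (side b)) (par base) (rcons W (b, y^-1)).
  rewrite -cats1; apply: reduced_word_cat => //; last first.
    by rewrite cats1 [unzip1 _]map_rcons -/(unzip1 W) WE.
  apply/reduced_word_cons; split=> //; [exact: parV|by move=> /(subgroupVE (par_sub _))].
have := amalgam_notin Wr'; rewrite -cats1 wprod_cat Wp /= mulg1 mulgV.
rewrite cats1 => /(_ par1) W1.
by have := size_rcons W (b, y^-1); rewrite W1.
Qed.

End ArtinAmalgam.

(** * Dihedral Artin groups *)

(** Z and Z/p are needed as multiplicative groups; they appear as translations of
    the integers and rotations of 'I_p. *)
Definition int_shift : bijection int.
Proof.
exists (fun z => z + 1)%R (fun z => z - 1)%R => z; first exact: GRing.addrK.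
exact: GRing.subrK.
Defined.

Definition ord_rotation p : bijection 'I_p := Bijection (@ordSK p) (@ord_predK p).

Lemma int_shiftX n : (int_shift ^+ n) 0%R = Posz n.
Proof.
elim: n => [|n IH]; first by [].
by rewrite expgS bijM IH /= -PoszD addn1.
Qed.

Lemma int_shiftX_eq1 n : int_shift ^+ n = 1 -> n = 0.
Proof. by move=> sn; have := int_shiftX n; rewrite sn /= => -[]. Qed.

Lemma ord_rotationX p n (i : 'I_p) :
  nat_of_ord ((ord_rotation p ^+ n) i) = ((i + n) %% p)%N.
Proof.
elim: n => [|n IH]; first by rewrite expg0 bij1 addn0 modn_small.
by rewrite expgS bijM /= IH -addn1 modnDml addn1 addnS.
Qed.

Lemma ord_rotationX_eq1 p n : p > 0 -> (ord_rotation p ^+ n = 1) <-> (p %| n).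
Proof.
move=> p0; split=> [rn|pn].
  have := ord_rotationX n (Ordinal p0); rewrite rn /= add0n /dvdn => <-.
  by [].
apply: bijectionP => i; apply: val_inj; rewrite /= ord_rotationX.
by case/dvdnP: pn => k ->; rewrite addnC modnMDl modn_small.
Qed.

(** Let y = x u. The relation of the edge says that z = y^p commutes with u, so the
    dihedral Artin group is the free product of <u, z> and <y> amalgamated over
    <z>. Modulo z this is the free product Z * Z/p, whose reduced sequences carry
    the action; the other vertices act trivially. *)
Section Dihedral.
Variables (Gamma : artin_graph) (Gamma_even : even_graph Gamma).
Notation V := (vertex Gamma).
Notation G := (artin_group Gamma).
Notation gen := (@artin_gen Gamma).
Notation par := (@standard_parabolic Gamma).
Variables x u : V.
Hypothesis xu_edge : [set x; u] \in edges Gamma.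
Local Notation p := (half_label x u).
Hypothesis p_gt1 : 1 < p.
Let p_gt0 : 0 < p := ltnW p_gt1.

Definition dih_quo : groupType := (bijection int * bijection 'I_p)%type.

(** Chosen so that u has value (1, 0) and x u has value (0, 1) in Z x Z/p. All
    values commute, so the relations hold whatever the labels. *)
Definition dih_val_gen v : dih_quo :=
  if v == u then (int_shift, 1) else
  if v == x then (int_shift^-1, ord_rotation p) else 1.

Lemma dih_val_gen_commute v w : commute (dih_val_gen v) (dih_val_gen w).
Proof.
have c1 (T : Type) (s : bijection T) : commute s s^-1.
  by apply: commuteV; apply: commute_refl.
have c2 (H : groupType) (s : H) : commute 1 s by apply/commute_sym; apply: commute1.
rewrite /dih_val_gen; case: (v == u); case: (w == u);
  case: (v == x); case: (w == x) => //; congr (_, _) => /=;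
  by rewrite ?mulgV ?mulVg ?mulg1 ?mul1g.
Qed.

Definition dih_val : G -> dih_quo := artin_hom dih_val_gen.

Lemma dih_val_rel v w : [set v; w] \in edges Gamma ->
  (dih_val_gen v * dih_val_gen w) ^+ half_label v w =
  (dih_val_gen w * dih_val_gen v) ^+ half_label v w.
Proof. by move=> _; rewrite dih_val_gen_commute. Qed.

Lemma dih_valM : {morph dih_val : g h / g * h}.
Proof. exact/(artin_homM Gamma_even)/dih_val_rel. Qed.

Lemma dih_val_u : dih_val (gen u) = (int_shift, 1).
Proof. by rewrite [LHS](artin_hom_gen Gamma_even dih_val_rel) /dih_val_gen eqxx. Qed.

Lemma dih_val_x : dih_val (gen x) = (int_shift^-1, ord_rotation p).
Proof.
rewrite [LHS](artin_hom_gen Gamma_even dih_val_rel) /dih_val_gen eqxx.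
by rewrite (negPf (edge_neq xu_edge)).
Qed.

Definition dih_y : G := gen x * gen u.
Definition dih_z : G := dih_y ^+ p.

Lemma dih_val_y : dih_val dih_y = (1, ord_rotation p).
Proof.
rewrite dih_valM dih_val_x dih_val_u; congr (_, _) => /=; first by gnorm.
by rewrite mulg1.
Qed.

Lemma pairX (H L : groupType) (a : H) (b : L) n :
  ((a, b) : (H * L)%type) ^+ n = (a ^+ n, b ^+ n).
Proof. by elim: n => [//|n IH]; rewrite !expgS IH. Qed.

Lemma dih_val_z : dih_val dih_z = 1.
Proof.
rewrite (morph_exp _ dih_valM) dih_val_y pairX; congr (_, _).
  by rewrite expg1n.
exact/ord_rotationX_eq1.
Qed.

Let oneM : {morph (fun _ : G => 1 : dih_quo) : g h / g * h}.
Proof. by move=> g h; rewrite mulg1. Qed.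
Notation tw := (twist_bij dih_valM oneM).

Definition dih_act_gen v : bijection (fp_elt dih_quo) :=
  if v == u then tw false (gen u) else
  if v == x then tw true dih_y * (tw false (gen u))^-1 else 1.

Lemma dih_act_rel v w : [set v; w] \in edges Gamma ->
  (dih_act_gen v * dih_act_gen w) ^+ half_label v w =
  (dih_act_gen w * dih_act_gen v) ^+ half_label v w.
Proof.
have xu : x != u := edge_neq xu_edge.
have yp : (tw true dih_y) ^+ p = 1.
  by rewrite -(morph_exp _ (twist_bijM _ _ _)) twist_bij_triv // dih_val_z.
have main : (dih_act_gen x * dih_act_gen u) ^+ p = (dih_act_gen u * dih_act_gen x) ^+ p.
  rewrite /dih_act_gen eqxx (negPf xu) eqxx; set a := tw true _; set b := tw false _.
  rewrite mulgVK [in LHS]yp.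
  have -> : b * (a * b^-1) = a ^ b^-1 by rewrite /conjg; gnorm.
  by rewrite -conjXg [a ^+ p]yp conj1g.
have triv v' w' q : dih_act_gen v' = 1 ->
    (dih_act_gen v' * dih_act_gen w') ^+ q = (dih_act_gen w' * dih_act_gen v') ^+ q.
  by move=> ->; rewrite mulg1 mul1g.
move=> vw.
have [v1|v1] := boolP ((v == u) || (v == x)); last first.
  by apply: triv; move: v1; rewrite negb_or /dih_act_gen => /andP[/negPf -> /negPf ->].
have [w1|w1] := boolP ((w == u) || (w == x)); last first.
  by apply/esym/triv; move: w1; rewrite negb_or /dih_act_gen => /andP[/negPf -> /negPf ->].
have := edge_neq vw; case/orP: v1 => /eqP ->; case/orP: w1 => /eqP -> //; rewrite ?eqxx //.
by rewrite half_labelC main.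
Qed.

Definition dih_act : G -> bijection (fp_elt dih_quo) := artin_hom dih_act_gen.

Lemma dih_actM : {morph dih_act : g h / g * h}.
Proof. exact/(artin_homM Gamma_even)/dih_act_rel. Qed.

Lemma dih_act_u : dih_act (gen u) = tw false (gen u).
Proof. by rewrite [LHS](artin_hom_gen Gamma_even dih_act_rel) /dih_act_gen eqxx. Qed.

Lemma dih_act_y : dih_act dih_y = tw true dih_y.
Proof.
rewrite /dih_y dih_actM dih_act_u [X in X * _](artin_hom_gen Gamma_even dih_act_rel).
by rewrite /dih_act_gen eqxx (negPf (edge_neq xu_edge)) mulgVK.
Qed.

Lemma dih_act_z : dih_act dih_z = 1.
Proof.
rewrite (morph_exp _ dih_actM) dih_act_y -(morph_exp _ (twist_bijM _ _ _)).
by rewrite twist_bij_triv // dih_val_z.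
Qed.

Definition dih_sub b : set G :=
  subgroup_gen (if b then (eq^~ dih_y) else (fun g => g = gen u \/ g = dih_z)).
Definition dih_center : set G := subgroup_gen (eq^~ dih_z).

Lemma dih_sub_sub b : is_subgroup (dih_sub b).
Proof. exact: subgroup_gen_subgroup. Qed.
Lemma dih_center_sub : is_subgroup dih_center.
Proof. exact: subgroup_gen_subgroup. Qed.

Lemma dih_center_in b g : dih_center g -> dih_sub b g.
Proof.
move: g; apply: subgroup_gen_ind; first exact: dih_sub_sub.
move=> _ ->; case: b; last by apply: mem_subgroup_gen; right.
by apply: (@subgroupX _ (dih_sub true)); [exact: dih_sub_sub | exact: mem_subgroup_gen].
Qed.

Lemma dih_center_val g : dih_center g -> dih_val g = 1.
Proof.
move: g; apply: subgroup_gen_ind; first exact: subgroup_eq_morph dih_valM oneM.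
by move=> _ ->; apply: dih_val_z.
Qed.

Lemma par_u_val e : par [set u] e -> dih_val e = 1 -> e = 1.
Proof.
suff Xn n : dih_val (gen u ^+ n) = 1 -> n = 0.
  move=> /par_set1 /subgroup_gen1[n [->|->]]; first by move=> /Xn ->; rewrite expg0.
  by rewrite (morph_inv dih_valM) => /eqP; rewrite invg_eq1 => /eqP /Xn ->;
     rewrite expg0 invg1.
by rewrite (morph_exp _ dih_valM) dih_val_u pairX => -[/int_shiftX_eq1].
Qed.

Lemma dih_z_commute : commute (gen u) dih_z.
Proof.
rewrite /commute /dih_z {2}artin_rel //.
rewrite /dih_y; elim: (half_label x u) => [|q IH].
  by rewrite !expg0 mulg1 mul1g.
by rewrite expgSr [in RHS]expgSr mulgA IH; gnorm.
Qed.

Lemma dih_sub_commute g h : dih_sub false g -> dih_sub false h -> commute g h.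
Proof.
apply: subgroup_gen_commute => a b [->|->] [->|->];
  by [exact: commute_refl|exact: dih_z_commute|apply/commute_sym; exact: dih_z_commute].
Qed.

Lemma dih_sub_false g : dih_sub false g ->
  exists e c, [/\ par [set u] e, dih_center c & g = e * c].
Proof.
move=> /subgroup_genU_commute[_ _ -> ->|e [c [ue Cc gE]]]; first exact: dih_z_commute.
by exists e, c; split=> //; apply/par_set1.
Qed.

Lemma dih_sub_val b g : dih_sub b g -> dih_val g = 1 -> dih_center g.
Proof.
case: b => [|/dih_sub_false[e [c [ue Cc ->]]]]; last first.
  by rewrite dih_valM (dih_center_val Cc) mulg1 => /(par_u_val ue) ->; rewrite mul1g.
have Xn n : dih_val (dih_y ^+ n) = 1 -> dih_center (dih_y ^+ n).
  rewrite (morph_exp _ dih_valM) dih_val_y pairX => -[_] /ord_rotationX_eq1 - /(_ p_gt0).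
  case/dvdnP => k ->; rewrite mulnC expgnA; apply: (@subgroupX _ dih_center); 
    first exact: dih_center_sub.
  exact: mem_subgroup_gen.
move=> /subgroup_gen1[n [->|->]]; first exact: Xn.
rewrite (morph_inv dih_valM) => /eqP; rewrite invg_eq1 => /eqP /Xn.
exact: subgroupV dih_center_sub.
Qed.

Lemma dih_word_notin s : reduced_word dih_sub dih_center s ->
  dih_center (wprod s) -> s = [::].
Proof.
move=> sr; apply: (@reduced_word_notin _ _ _ _ dih_valM oneM _ dih_actM _ _ _ _ _ _ _ sr).
- move=> b g bg; move: (g) bg; apply: subgroup_gen_ind.
    exact: subgroup_eq_morph dih_actM (twist_bijM _ _ _).
  case: b => [_ ->|_ [->|->]]; [exact: dih_act_y | exact: dih_act_u|].
  by rewrite dih_act_z twist_bij_triv // dih_val_z.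
- by move=> b g; apply: dih_sub_val.
- exact: dih_center_in.
- exact: dih_center_val.
Qed.

Lemma dih_u_in : dih_sub false (gen u).
Proof. by apply: mem_subgroup_gen; left. Qed.

Lemma par_u_in e : par [set u] e -> dih_sub false e.
Proof.
move: e; apply: par_ind; first exact: dih_sub_sub.
by move=> v /finset.set1P ->; apply: dih_u_in.
Qed.

(** Write k = a t b with a, b in the abelian subgroup <u, z> and t a word that is
    empty or starts and ends in <y>. If e commutes with k it commutes with t; for t
    nonempty, e t e^-1 t^-1 would be a reduced word equal to 1. *)
Lemma dihedral_centralizer e k : par [set u] e -> e <> 1 -> par [set x; u] k ->
  commute e k -> commute (gen u) k.
Proof.
move=> ue e1 xuk ek; suff : dih_sub false k by apply: dih_sub_commute dih_u_in.
have Ae := par_u_in ue.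
have nCe : ~ dih_center e by move=> /dih_center_val /(par_u_val ue).
have : has_form dih_sub dih_center k.
  have := @has_form_gen _ dih_sub dih_center dih_sub_sub dih_center_sub _
    (fun g => g = gen u \/ g = dih_y).
  apply.
  - by move=> b g _; apply: dih_center_in.
  - move=> _ [->|->]; [exists false; exact: dih_u_in | exists true; exact: mem_subgroup_gen].
  move: k xuk {ek}; apply: par_ind; first exact: subgroup_gen_subgroup.
  move=> v /finset.set2P[] ->; last by apply: mem_subgroup_gen; left.
  have -> : gen x = dih_y * (gen u)^-1 by rewrite mulgK.
  have gs := @subgroup_gen_subgroup G (fun g => g = gen u \/ g = dih_y).
  apply: (subgroupM gs); first by apply: mem_subgroup_gen; right.
  by apply: (subgroupV gs); apply: mem_subgroup_gen; left.
move=> /(has_form_split dih_sub_sub false) [a [t [b [Aa Ab kE tr t_alt]]]]; rewrite kE.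
case: t_alt => [->|t_alt].
  by rewrite mulg1; apply: (subgroupM (dih_sub_sub false)).
have et : commute e (wprod t).
  have := ek; rewrite kE => /(commuteM (commuteV (dih_sub_commute Ae Aa))).
  move=> /commute_sym ek'.
  have := commuteM (commute_sym ek') (commuteV (dih_sub_commute Ae Ab)).
  by gnorm.
suff wr : reduced_word dih_sub dih_center
    ((false, e) :: t ++ (false, e^-1) :: winv t).
  suff /(dih_word_notin wr) : dih_center (wprod ((false, e) :: t ++ (false, e^-1) :: winv t)) by [].
  rewrite /= wprod_cat /= wprod_inv !mulgA et; gnorm.
  by apply: subgroup1; exact: dih_center_sub.
have [bt tb brt rtb] := alternating_around t_alt.
apply/reduced_word_cons; split=> //.
  rewrite [unzip1 _]map_cat map_cons -cat_cons alternating_cat1 -/(unzip1 (winv t)).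
  by rewrite unzip1_winv brt rcons_cons t_alt.
apply: reduced_word_cat => //; last first.
  rewrite [unzip1 _]map_cat map_cons alternating_cat1 -/(unzip1 (winv t)).
  by rewrite unzip1_winv brt tb.
apply/reduced_word_cons; split.
- exact: (subgroupV (dih_sub_sub false)) Ae.
- by move=> /(subgroupVE dih_center_sub).
- by rewrite unzip1_winv.
- exact: (reduced_word_inv dih_sub_sub dih_center_sub tr).
Qed.

(** The commutator of u and y is a reduced word. *)
Lemma dihedral_noncommute : ~ commute (gen u) (gen x).
Proof.
move=> ux.
have uy : commute (gen u) dih_y by apply: commuteM => //; apply: commute_refl.
suff wr : reduced_word dih_sub dih_center
    [:: (false, gen u); (true, dih_y); (false, (gen u)^-1); (true, dih_y^-1)].
  have w1 (a b : G) : commute a b -> a * (b * (a^-1 * (b^-1 * 1))) = 1.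
    by move=> ab; rewrite mulg1 !mulgA ab; gnorm.
  by have := dih_word_notin wr; rewrite /= w1 // => /(_ (subgroup1 dih_center_sub)).
have nCu : ~ dih_center (gen u).
  by move=> /dih_center_val; rewrite dih_val_u => /(congr1 fst) /(@int_shiftX_eq1 1).
have nCy : ~ dih_center dih_y.
  move=> /dih_center_val; rewrite dih_val_y => /(congr1 snd) /(@ord_rotationX_eq1 _ 1 p_gt0).
  by rewrite dvdn1 => /eqP pE; move: p_gt1; rewrite pE.
have Ay : dih_sub true dih_y by apply: mem_subgroup_gen.
split=> // l; rewrite !inE => /or4P[] /eqP -> /=; split=> //.
- exact: dih_u_in.
- exact: subgroupV (dih_sub_sub false) dih_u_in.
- by move/(subgroupVE dih_center_sub).
- exact: subgroupV (dih_sub_sub true) Ay.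
- by move/(subgroupVE dih_center_sub).
Qed.
End Dihedral.

Lemma half_label_gt1 (Gamma : artin_graph) (x u : vertex Gamma) :
  even_graph Gamma -> [set x; u] \in edges Gamma -> label [set x; u] <> 2 ->
  1 < half_label x u.
Proof.
move=> ev xu m2; have := label_ge2 xu; have := ev _ xu.
rewrite /half_label; move: (label _) m2 => m m2 m_odd m_ge2.
by case: m m2 m_odd m_ge2 => [|[|[|[|m]]]].
Qed.

(** If e and f are both nontrivial, the centralizer statement for u shows that u
    commutes with f, and the one for x that x commutes with u. *)
Lemma dihedral_commute_trivial (Gamma : artin_graph) (x u : vertex Gamma) e f :
  even_graph Gamma -> [set x; u] \in edges Gamma -> label [set x; u] <> 2 ->
  standard_parabolic [set u] e -> standard_parabolic [set x] f ->
  commute e f -> f <> 1 -> e = 1.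
Proof.
move=> ev xu m2 ue xf ef f1; apply: contrapT => e1.
have p1 := half_label_gt1 ev xu m2.
have xuf : standard_parabolic [set x; u] f.
  by apply: par_mono xf; apply: finset.subsetUl.
have uf := dihedral_centralizer ev xu p1 ue e1 xuf ef.
have ux : [set u; x] \in edges Gamma by rewrite finset.setUC.
have p1' : 1 < half_label u x by rewrite half_labelC.
have uxu : standard_parabolic [set u; x] (artin_gen u).
  by apply: par_gen; rewrite !inE eqxx.
have := dihedral_centralizer ev ux p1' xf f1 uxu (commute_sym uf).
by move=> /commute_sym; apply: dihedral_noncommute.
Qed.

(** * Labels of triangles *)

(** Let u, v, w span a triangle in which the labels 2 a of uv and 2 b of uw differ
    from 2. The Coxeter group of the triangle is infinite because it acts
    transitively on the natural numbers, seen as the vertices of a half-line: u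
    swaps the ends 2 i and 2 i + 1 of the even edges, and the ends of each odd edge
    {2 i + 1, 2 i + 2} are swapped by one of v and w and fixed by the other. Thus v
    and w commute, which gives the relation of vw as its label is even. The odd
    edges are coloured by blocks of a - 1 edges for v and b - 1 edges for w; then
    an orbit of u and v is either a path with 2 a vertices, on which (u v)^a and
    (v u)^a are both the reversal, or an even edge whose ends are fixed by v. The
    same holds for u and w, with b. *)
Section LineAction.

Definition even_swap r := if odd r then r.-1 else r.+1.
Definition odd_swap (c : pred nat) r :=
  if odd r then (if c r./2 then r.+1 else r)
  else (if (0 < r) && c (r./2).-1 then r.-1 else r).

Lemma even_swapK : involutive even_swap.
Proof. by move=> r; rewrite /even_swap; case: ifP; case: ifP; lia. Qed.

Lemma odd_swap_odd c i : odd_swap c i.*2.+1 = if c i then i.+1.*2 else i.*2.+1.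
Proof. by rewrite /odd_swap /= odd_double /= uphalf_double doubleS. Qed.

Lemma odd_swap0 c : odd_swap c 0 = 0.
Proof. by []. Qed.

Lemma odd_swap_even c i :
  odd_swap c i.+1.*2 = if c i then i.*2.+1 else i.+1.*2.
Proof. by rewrite /odd_swap odd_double doubleK double_gt0. Qed.

Lemma odd_evenP r : (exists i, r = i.*2) \/ (exists i, r = i.*2.+1).
Proof. by have := odd_double_half r; case: (odd r) => <-; [right|left]; exists r./2. Qed.

Lemma odd_swapK c : involutive (odd_swap c).
Proof.
move=> r; case: (odd_evenP r) => -[[|i] ->].
- by rewrite odd_swap0.
- by rewrite odd_swap_even; case ci: (c i); rewrite (odd_swap_odd, odd_swap_even) ci.
- by rewrite odd_swap_odd; case ci: (c 0); rewrite (odd_swap_even, odd_swap_odd) ci.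
- by rewrite odd_swap_odd; case ci: (c i.+1); rewrite (odd_swap_even, odd_swap_odd) ci.
Qed.

Definition even_bij := Bijection even_swapK even_swapK.
Definition odd_bij c := Bijection (odd_swapK c) (odd_swapK c).

Lemma even_bij_sq : even_bij * even_bij = 1.
Proof. by apply: bijectionP => r; apply: even_swapK. Qed.
Lemma odd_bij_sq c : odd_bij c * odd_bij c = 1.
Proof. by apply: bijectionP => r; apply: odd_swapK. Qed.

Lemma odd_bij_commute c : commute (odd_bij c) (odd_bij (predC c)).
Proof.
apply: bijectionP => r; rewrite !bijM /=; case: (odd_evenP r) => -[[|i] ->].
- by rewrite !odd_swap0.
- by rewrite !odd_swap_even /=; case ci: (c i);
    rewrite /= ?odd_swap_odd ?odd_swap_even /= ?odd_swap_odd ?odd_swap_even /= ci.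
- by rewrite !odd_swap_odd /=; case ci: (c 0);
    rewrite /= ?(odd_swap_even, odd_swap_odd) /= ?ci.
- by rewrite !odd_swap_odd /=; case ci: (c i.+1);
    rewrite /= ?(odd_swap_even, odd_swap_odd) /= ?ci.
Qed.

Variable c : pred nat.

Definition line_step (e : bool) := if e then odd_swap c else even_swap.
(** The powers occurring in the braid relation are unfolded into alternating single
    steps, along which the position can be followed. *)
Fixpoint line_walk (e : bool) t r :=
  if t is t'.+1 then line_step (e (+) odd t') (line_walk e t' r) else r.

Lemma line_walk_even a r : line_walk false a.*2 r = ((odd_bij c * even_bij) ^+ a) r.
Proof.
elim: a => [//|a IH]; rewrite doubleS /= IH odd_double expgS.
by [].
Qed.

Lemma line_walk_odd a r : line_walk true a.*2 r = ((even_bij * odd_bij c) ^+ a) r.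
Proof.
elim: a => [//|a IH]; rewrite doubleS /= IH odd_double expgS.
by [].
Qed.

(* A maximal block of edges of colour c: the vertices from l.*2 to (l + a).*2.-1. *)
Variables (l a : nat).
Hypotheses (a_gt0 : 0 < a) (c_in : forall i, l <= i -> i.+1 < l + a -> c i)
  (c_before : 0 < l -> ~~ c l.-1) (c_after : ~~ c (l + a).-1).

Lemma line_step_even q : line_step false (l.*2 + q) =
  if odd q then (l.*2 + q).-1 else (l.*2 + q).+1.
Proof. by rewrite /= /even_swap oddD odd_double. Qed.

Lemma line_step_odd q : q < a.*2 -> line_step true (l.*2 + q) =
  if odd q then (if q.+1 < a.*2 then (l.*2 + q).+1 else l.*2 + q)
  else (if 0 < q then (l.*2 + q).-1 else l.*2 + q).
Proof.
move=> qa; rewrite /=; case: (odd_evenP q) => -[i qE]; rewrite qE ?odd_double /= ?odd_double /=.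
  case: i qE => [|i] qE.
    rewrite addn0 /=; case: (posnP l) => [->//|l0].
    by rewrite -(prednK l0) odd_swap_even (negPf (c_before l0)).
  by rewrite -doubleD addnS odd_swap_even c_in //; lia.
rewrite addnS -doubleD odd_swap_odd; case: ltnP => ia.
  by rewrite c_in //; lia.
have -> : l + i = (l + a).-1 by lia.
by rewrite (negPf c_after).
Qed.

(** A walk that starts upwards is reflected at the upper end of the block, where
    the odd swap fixes the vertex, and then goes down. *)
Lemma line_walk_up k t : k < a.*2 -> t <= a.*2 ->
  line_walk (odd k) t (l.*2 + k) =
  l.*2 + (if k + t < a.*2 then k + t else a.*2.*2.-1 - (k + t)).
Proof.
move=> ka; elim: t => [|t IH] ta; first by rewrite addn0 ka.
rewrite /= IH ?(ltnW ta) // -oddD; set q := (if _ then _ else _).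
have qa : q < a.*2 by rewrite /q; case: ifP; lia.
case okt : (odd (k + t)).
  by rewrite line_step_odd // /q; move: okt qa; rewrite /q; do !case: ifP; lia.
by rewrite line_step_even /q; move: okt qa; rewrite /q; do !case: ifP; lia.
Qed.

(** A walk that starts downwards is reflected at the lower end of the block. *)
Lemma line_walk_down k t : k < a.*2 -> t <= a.*2 ->
  line_walk (~~ odd k) t (l.*2 + k) =
  l.*2 + (if t <= k then k - t else (t - k).-1).
Proof.
move=> ka; elim: t => [|t IH] ta; first by rewrite subn0.
rewrite /= IH ?(ltnW ta) // addNb -oddD; set q := (if _ then _ else _).
have qa : q < a.*2 by rewrite /q; case: ifP; lia.
case okt : (odd (k + t)).
  by rewrite line_step_even /q; move: okt qa; rewrite /q; do !case: ifP; lia.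
by rewrite line_step_odd // /q; move: okt qa; rewrite /q; do !case: ifP; lia.
Qed.

Lemma line_braid_block k : k < a.*2 ->
  ((even_bij * odd_bij c) ^+ a) (l.*2 + k) = ((odd_bij c * even_bij) ^+ a) (l.*2 + k).
Proof.
move=> ka; rewrite -line_walk_odd -line_walk_even.
have E : line_walk (odd k) a.*2 (l.*2 + k) = line_walk (~~ odd k) a.*2 (l.*2 + k).
  by rewrite line_walk_up // line_walk_down //; do !case: ifP; lia.
by move: E; case: (odd k).
Qed.

End LineAction.

Lemma line_braid_free c a i : ~~ c i -> (0 < i -> ~~ c i.-1) ->
  forall r, (r = i.*2 \/ r = i.*2.+1) ->
  ((even_bij * odd_bij c) ^+ a) r = ((odd_bij c * even_bij) ^+ a) r.
Proof.
move=> ci ci' r0 r0E; pose D r := r = i.*2 \/ r = i.*2.+1.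
have VD r : D r -> odd_swap c r = r.
  case=> ->; last by rewrite odd_swap_odd (negPf ci).
  case: (posnP i) => [->//|i0].
  by rewrite -(prednK i0) odd_swap_even (negPf (ci' i0)).
have UD r : D r -> D (even_swap r).
  by rewrite /D /even_swap; case=> ->; rewrite /= odd_double; [right|left].
suff [-> _] : ((even_bij * odd_bij c) ^+ a) r0 = ((odd_bij c * even_bij) ^+ a) r0 /\
  D (((odd_bij c * even_bij) ^+ a) r0) by [].
elim: a => [//|a [IH IHD]]; rewrite !expgS !bijM /= IH VD // VD; last exact: UD.
by split=> //; apply: UD.
Qed.

(** The vertex r is an end of the even edge of index i; it lies in a block as soon
    as one of the two neighbouring odd edges has colour c. *)
Lemma line_braid (c : pred nat) a : 1 < a ->
  (forall i, c i -> exists l, [/\ l <= i, i.+1 < l + a,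
     forall j, l <= j -> j.+1 < l + a -> c j, 0 < l -> ~~ c l.-1 & ~~ c (l + a).-1]) ->
  (even_bij * odd_bij c) ^+ a = (odd_bij c * even_bij) ^+ a.
Proof.
move=> a1 blk; apply: bijectionP => r; pose i := r./2.
have rE : r = i.*2 \/ r = i.*2.+1.
  by have := odd_double_half r; rewrite -/i; case: (odd r) => <-; [right|left].
have inblk j : c j -> (j = i \/ j.+1 = i) ->
    ((even_bij * odd_bij c) ^+ a) r = ((odd_bij c * even_bij) ^+ a) r.
  move=> /blk[l [lj ja cin cb ca]] ji.
  have -> : r = l.*2 + (r - l.*2) by lia.
  by apply: line_braid_block => //; lia.
case ci: (c i); first by apply: (inblk i ci); left.
have [i0|i0] := posnP i; first by apply: (@line_braid_free _ _ i _ _ _ rE); rewrite ?ci ?i0.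
case ci': (c i.-1); first by apply: (inblk _ ci'); right; rewrite prednK.
by apply: (@line_braid_free _ _ i _ _ _ rE); rewrite ?ci ?ci'.
Qed.

Section TriangleLine.
Local Open Scope nat_scope.
Variables a b : nat.
Hypotheses (a_gt1 : 1 < a) (b_gt1 : 1 < b).

Definition line_colour : pred nat := fun i => i %% (a + b - 2) < a.-1.

Lemma line_colourE q j : j < a + b - 2 ->
  line_colour (q * (a + b - 2) + j) = (j < a.-1).
Proof. by move=> jN; rewrite /line_colour modnMDl modn_small. Qed.

Lemma line_braid_true :
  ((even_bij * odd_bij line_colour) ^+ a = (odd_bij line_colour * even_bij) ^+ a)%g.
Proof.
apply: line_braid => // i im; rewrite /line_colour in im.
have N0 : 0 < a + b - 2 by lia.
rewrite (divn_eq i (a + b - 2)); set q := _ %/ _; set j := _ %% _ in im *.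
exists (q * (a + b - 2)); split.
- by rewrite leq_addr.
- lia.
- move=> k lk ka; have -> : k = q * (a + b - 2) + (k - q * (a + b - 2)) by lia.
  by rewrite line_colourE; lia.
- move=> l0; have q0 : 0 < q by case: (q) l0.
  have -> : (q * (a + b - 2)).-1 = q.-1 * (a + b - 2) + (a + b - 2).-1.
    by case: (q) q0 => // q' _; rewrite mulSn /=; lia.
  by rewrite line_colourE; lia.
- have -> : (q * (a + b - 2) + a).-1 = q * (a + b - 2) + a.-1 by lia.
  by rewrite line_colourE; lia.
Qed.

Lemma line_braid_false :
  ((even_bij * odd_bij (predC line_colour)) ^+ b =
   (odd_bij (predC line_colour) * even_bij) ^+ b)%g.
Proof.
apply: line_braid => // i im; rewrite /= /line_colour -leqNgt in im.
have N0 : 0 < a + b - 2 by lia.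
have jN := ltn_pmod i N0; move: im jN.
rewrite {3 4}(divn_eq i (a + b - 2)); set q := _ %/ _; set j := _ %% _ => im jN.
exists (q * (a + b - 2) + a.-1); split.
- by rewrite leq_add2l.
- lia.
- move=> k lk ka; have -> : k = q * (a + b - 2) + (k - q * (a + b - 2)) by lia.
  by rewrite /= line_colourE; lia.
- move=> l0.
  have -> : (q * (a + b - 2) + a.-1).-1 = q * (a + b - 2) + a.-2 by lia.
  by rewrite /= line_colourE; lia.
- have -> : (q * (a + b - 2) + a.-1 + b).-1 = q.+1 * (a + b - 2) + 0 by rewrite mulSn; lia.
  by rewrite /= line_colourE; lia.
Qed.
End TriangleLine.

Section FCTriangle.
Variables (Gamma : artin_graph) (Gamma_even : even_graph Gamma)
  (Gamma_FC : FC_type Gamma).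
Notation V := (vertex Gamma).
Variables u v w : V.
Hypotheses (uv : [set u; v] \in edges Gamma) (uw : [set u; w] \in edges Gamma)
  (vw : [set v; w] \in edges Gamma).
Hypotheses (uv_label : label [set u; v] <> 2) (uw_label : label [set u; w] <> 2).

Let a := half_label u v.
Let b := half_label u w.
Let a_gt1 : 1 < a := half_label_gt1 Gamma_even uv uv_label.
Let b_gt1 : 1 < b := half_label_gt1 Gamma_even uw uw_label.

Let S : {set V} := [set z | [|| z == u, z == v | z == w]].

Let line_gen (z : V) : bijection nat :=
  if z == u then even_bij else
  if z == v then odd_bij (line_colour a b) else odd_bij (predC (line_colour a b)).

Let line_gen_u : line_gen u = even_bij.
Proof. by rewrite /line_gen eqxx. Qed.
Let line_gen_v : line_gen v = odd_bij (line_colour a b).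
Proof. by rewrite /line_gen eq_sym (negPf (edge_neq uv)) eqxx. Qed.
Let line_gen_w : line_gen w = odd_bij (predC (line_colour a b)).
Proof.
by rewrite /line_gen !(eq_sym w) (negPf (edge_neq uw)) (negPf (edge_neq vw)).
Qed.

Let line_gen_rel y z : y \in S -> z \in S -> [set y; z] \in edges Gamma ->
  (line_gen y * line_gen z) ^+ half_label y z =
  (line_gen z * line_gen y) ^+ half_label y z.
Proof.
rewrite !inE => yS zS yz; have := edge_neq yz.
have UV := line_braid_true a_gt1 b_gt1.
have UW := line_braid_false a_gt1 b_gt1.
have VW := odd_bij_commute (line_colour a b).
case/or3P: yS => /eqP ->; case/or3P: zS => /eqP -> //; rewrite ?eqxx // => _;
  rewrite ?(line_gen_u, line_gen_v, line_gen_w).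
- exact: UV.
- exact: UW.
- by rewrite half_labelC -[half_label u v]/a UV.
- by rewrite VW.
- by rewrite half_labelC -[half_label u w]/b UW.
- by rewrite VW.
Qed.

Let f (z : vertex (induced_subgraph S)) : bijection nat := line_gen (val z).

Let f_rel r :
  (@artin_rels (induced_subgraph S) `|` @square_rels _)%classic r ->
  eval_word f r.1 = eval_word f r.2.
Proof.
case=> [[y [z [yz ->]]]|[z ->]] /=; last first.
  rewrite /eval_letter /= mulg1 /f /line_gen.
  by case: ifP => _; [exact: even_bij_sq|case: ifP => _; exact: odd_bij_sq].
have yzE : lift_edge [set y; z] = [set val y; val z].
  by rewrite /lift_edge imsetU1 finset.imset_set1.
move: yz; rewrite inE yzE => yz.
have -> : (label [set val y; val z] = (half_label (val y) (val z)).*2)%N.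
  by rewrite -[LHS]odd_double_half (negPf (Gamma_even yz)) add0n.
by rewrite !eval_alt_even; apply: line_gen_rel => //; apply: valP.
Qed.

Lemma FC_triangle_absurd : False.
Proof.
have SC : induces_complete S.
  move=> y z; rewrite !inE => yS zS.
  case/or3P: yS => /eqP ->; case/or3P: zS => /eqP -> //; rewrite ?eqxx // => _;
    by rewrite // finset.setUC.
have := Gamma_FC SC; rewrite /spherical_type /coxeter_group.
set act := pres_lift (R := (@artin_rels (induced_subgraph S) `|` @square_rels _)%classic) f.
move=> fin.
have uS : u \in S by rewrite inE eqxx.
have vS : v \in S by rewrite inE eqxx orbT.
have wS : w \in S by rewrite inE eqxx !orbT.
have reach r : exists g, act g 0%N = r.
  elim: r => [|r [g gr]].
    by exists 1; rewrite /act (morph_one (pres_liftM f_rel)).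
  have step (z : vertex (induced_subgraph S)) : f z r = r.+1 -> exists g, act g 0%N = r.+1.
    move=> zr; exists (pres_gen _ z * g).
    by rewrite /act (pres_liftM f_rel) (pres_lift_gen f_rel) bijM -/act gr.
  case: (odd_evenP r) => -[i rE].
    apply: (step (exist _ u uS)); rewrite /f /= line_gen_u rE /=.
    by rewrite /even_swap odd_double.
  case ci: (line_colour a b i).
    apply: (step (exist _ v vS)); rewrite /f /= line_gen_v rE /=.
    by rewrite odd_swap_odd ci.
  apply: (step (exist _ w wS)); rewrite /f /= line_gen_w rE /=.
  by rewrite odd_swap_odd /= ci.
have /(finite_image (fun g => act g 0%N)) := fin.
have -> : ([set act g 0%N | g in [set: _]] = [set: nat])%classic.
  by rewrite predeqE => r; split=> // _; have [g gr] := reach r; exists g.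
exact: infinite_nat.
Qed.
End FCTriangle.

(** Otherwise the three vertices would induce a complete subgraph whose Coxeter
    group acts transitively on an infinite set. *)
Lemma FC_triangle (Gamma : artin_graph) (u v w : vertex Gamma) :
  even_graph Gamma -> FC_type Gamma ->
  [set u; v] \in edges Gamma -> [set u; w] \in edges Gamma ->
  [set v; w] \in edges Gamma -> label [set u; v] <> 2 -> label [set u; w] = 2.
Proof.
move=> ev fc uv uw vw uv2; apply: contrapT => uw2.
exact: (FC_triangle_absurd ev fc uv uw vw uv2 uw2).
Qed.

(** * Centralizers of powers of a generator *)

Section Centralizer.
Variables (Gamma : artin_graph) (Gamma_even : even_graph Gamma)
  (Gamma_FC : FC_type Gamma).
Notation V := (vertex Gamma).
Notation G := (artin_group Gamma).
Notation gen := (@artin_gen Gamma).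
Notation par := (@standard_parabolic Gamma).
Implicit Types (S T D : {set V}).

Variables (x : V) (D : {set V}) (f : G).
Hypotheses (xD : x \notin D) (x_adj : forall v, v \in D -> [set x; v] \in edges Gamma)
  (xf : par [set x] f) (f1 : f <> 1).

Definition label2 : {set V} := [set v | label [set x; v] == 2].

(** By induction on S. Let u in S have a label different from 2 with x. If u is
    adjacent to the rest of S, all other labels at x and at u are 2, so G_S is the
    product of <u> and of a subgroup commuting with x, and the component in <u> is
    trivial by the dihedral case. Otherwise u has a nonneighbour n in S. In the
    splitting along u and n, a letter that omits n and lies outside the base never
    conjugates f into the base, by the induction hypothesis. Write h = p t q with
    p and q omitting u, and t empty or starting and ending with such letters: then
    h f h^-1 = f forces t to be empty, so that h omits u. *)
Lemma centralizer_par S h : S \subset D -> par S h -> commute h f ->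
  par (S :&: label2) h.
Proof.
move: {2}(#|S|) (leqnn #|S|) h => m; elim: m S => [|m IH] S Sm h SD Sh hf.
  move: Sm Sh; rewrite leqn0 cards_eq0 => /eqP -> /par_set0 ->.
  exact: par1.
have [S2|/fintype.subsetPn[u uS u2]] := boolP (S \subset label2).
  by apply: par_mono Sh; rewrite finset.subsetI fintype.subxx.
have xu := x_adj (fintype.subsetP SD _ uS).
have xu2 : label [set x; u] <> 2 by move: u2; rewrite inE => /eqP.
have [u_adj|] := boolP [forall n in S, (n != u) ==> ([set u; n] \in edges Gamma)].
  pose M := S :\ u.
  have M2 v : v \in M -> label [set x; v] = 2 /\ label [set u; v] = 2.
    rewrite !inE => /andP[vu vS].
    have uv : [set u; v] \in edges Gamma.
      by have /forall_inP/(_ v vS)/implyP := u_adj; apply.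
    have xv := x_adj (fintype.subsetP SD _ vS).
    split; first exact: (FC_triangle Gamma_even Gamma_FC xu xv uv xu2).
    have ux : [set u; x] \in edges Gamma by rewrite finset.setUC.
    by apply: (FC_triangle Gamma_even Gamma_FC ux uv xv); rewrite finset.setUC.
  have uM a v : a \in [set u] -> v \in M -> commute (gen a) (gen v).
    move=> /finset.set1P -> vM; have [_] := M2 _ vM.
    apply: commute_label2 => //.
    move: vM; rewrite !inE => /andP[vu vS].
    by have /forall_inP/(_ v vS)/implyP := u_adj; apply.
  have xM a v : a \in [set x] -> v \in M -> commute (gen a) (gen v).
    move=> /finset.set1P -> vM; have [x2 _] := M2 _ vM.
    apply: commute_label2 => //; apply: x_adj; apply: (fintype.subsetP SD).
    by move: vM; rewrite !inE => /andP[].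
  have [|e [y [ue My hE]]] := par_setU_commute uM (x := h).
    by rewrite finset.setD1K.
  have fy : commute f y by apply: (par_commute xM).
  have ef : commute e f.
    have -> : e = h * y^-1 by rewrite hE mulgK.
    by apply: commute_sym; apply: commuteM (commute_sym hf) (commuteV fy).
  have e1 := dihedral_commute_trivial Gamma_even xu xu2 ue xf ef f1.
  rewrite hE e1 mul1g; apply: par_mono My; apply/fintype.subsetP => v vM.
  have [x2 _] := M2 _ vM; move: vM; rewrite !inE x2 eqxx.
  by case/andP => _ ->.
move=> /forall_inPn[n nS]; rewrite negb_imply => /andP[nu une].
have un : u != n by rewrite eq_sym.
have fB : par (base u n) f.
  apply: par_mono xf; rewrite finset.sub1set !inE negb_or.
  by apply/andP; split; apply: contraNneq xD => ->; apply: (fintype.subsetP SD).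
have fS b : par (side u n b) f by apply: par_mono fB; apply: base_side.
have small b : #|S :&: side u n b| <= m.
  rewrite -ltnS; apply: leq_trans Sm; apply: proper_card.
  rewrite finset.properEneq finset.subsetIl andbT; apply: contraNneq (side_notin u n S b) => ->.
  by case: b.
have subD b : S :&: side u n b \subset D.
  by apply: fintype.subset_trans SD; apply: finset.subsetIl.
pose r := retract (base u n).
have rC q : par (base u n) (q * f * q^-1) -> q * f * q^-1 = r q * f * (r q)^-1.
  move=> /(retract_id Gamma_even); rewrite -/r => <-.
  rewrite /r !(retractM Gamma_even) !(retractV Gamma_even) (retract_id Gamma_even fB).
  by [].
have rS b c q : par (S :&: side u n b) q -> par (S :&: side u n c) (r q).
  move=> /(retract_par Gamma_even (S := base u n)); apply: par_mono.
  rewrite finset.setICA; apply: finset.setIS.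
  by apply: fintype.subset_trans (base_side u n c); apply: finset.subsetIl.
have noC g : par (S :&: side u n false) g -> par (base u n) (g * f * g^-1) ->
    par (base u n) g.
  move=> Sg /rC gE; rewrite -(mulVKg (r g) g).
  apply: parM; first exact: retract_in.
  (* (r g)^-1 g commutes with f, so the induction hypothesis removes u from it *)
  have rg : par (S :&: side u n false) ((r g)^-1 * g).
    by apply: parM => //; apply: parV; apply: rS Sg.
  have comm : commute ((r g)^-1 * g) f.
    rewrite /commute.
    have -> : (r g)^-1 * g * f = (r g)^-1 * (g * f * g^-1) * g by gnorm.
    by rewrite gE; gnorm.
  apply: par_mono (IH _ (small false) _ (subD false) rg comm).
  apply/fintype.subsetP => v; rewrite !inE negb_or => /andP[/andP[_ vn] v2].
  by rewrite vn andbT; apply: contraTneq v2 => ->; apply/eqP.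
have [p [t [q [Sp Sq hE tr t_alt]]]] :=
  has_form_split (fun b => par_sub (S :&: side u n b)) true (amalgam_form Gamma_even un Sh).
case: t_alt => [t0|t_alt].
  have Sh' : par (S :&: side u n true) h by rewrite hE t0 /= mulg1; apply: parM.
  apply: par_mono (IH _ (small true) _ (subD true) Sh' hf).
  by apply: finset.setSI; apply: finset.subsetIl.
have [tt ttr _ _] := alternating_around t_alt.
have tr' := amalgam_wordsT tr.
have yS : par (side u n true) (p^-1 * f * p).
  have Sp' : par (side u n true) p by apply: par_mono Sp; apply: finset.subsetIr.
  by apply: parM => //; apply: parM => //; apply: parV.
exfalso; have tE : wprod t * (q * f * q^-1) * (wprod t)^-1 = p^-1 * f * p.
  have hfE : f = h * f * h^-1 by rewrite hf; gnorm.
  by rewrite [f in RHS]hfE hE; gnorm.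
(* either q already takes f out of the base, or q acts on f like r q, which is
   absorbed in the last letter of t *)
have [Bq|nBq] := pselect (par (base u n) (q * f * q^-1)); last first.
  apply: (conj_word_absurd Gamma_even un une tr' _ nBq _ yS tE).
    have Sq' : par (side u n true) q by apply: par_mono Sq; apply: finset.subsetIr.
    by apply: parM; [apply: parM Sq' (fS _)|apply: parV].
  by [].
case: (lastP t) tr tr' tE t_alt tt ttr => [|t' [d g]] tr tr' tE t_alt tt ttr.
  by move: t_alt.
have dE : d = false.
  by move: ttr; rewrite [unzip1 _]map_rcons alternating_rcons /= => /andP[_]; case: (d).
subst d.
have [Sg nBg] : par (S :&: side u n false) g /\ ~ par (base u n) g.
  by case: tr => /(_ (false, g)); rewrite mem_rcons mem_head => /(_ isT).
have tr'' : reduced_word (fun b => par (side u n b)) (par (base u n)) t'.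
  by apply: (@reduced_word_catl _ _ _ _ [:: (false, g)]); rewrite cats1.
have Sg' : par (S :&: side u n false) (g * r q) by apply: parM => //; apply: rS Sq.
apply: (conj_word_absurd Gamma_even un une tr'' _ _ _ yS (g := g * r q * f * (g * r q)^-1) (d := false)).
- have Sg'' : par (side u n false) (g * r q) by apply: par_mono Sg'; apply: finset.subsetIr.
  by apply: parM; [apply: parM Sg'' (fS _)|apply: parV].
- move=> /(noC _ Sg') /(subgroupMr (par_sub _) (retract_in Gamma_even (base u n) q)).
  exact: nBg.
- by rewrite rcons_cons -[rcons _ _](map_rcons _ t' (false, g)).
rewrite -tE (rC _ Bq) -cats1 wprod_cat /= mulg1.
by gnorm.
Qed.
End Centralizer.

(** * Intersections along a splitting *)

Lemma cons_rconsP (X Y : Type) (a : X) (b : Y) s :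
  exists s' c d, (a, b) :: s = rcons s' (c, d).
Proof.
exists (belast (a, b) s), (last (a, b) s).1, (last (a, b) s).2.
by rewrite -surjective_pairing -lastI.
Qed.

Section Intersections.
Variables (Gamma : artin_graph) (Gamma_even : even_graph Gamma).
Notation V := (vertex Gamma).
Notation G := (artin_group Gamma).
Notation gen := (@artin_gen Gamma).
Notation par := (@standard_parabolic Gamma).
Implicit Types (S T : {set V}) (P Q R : set G) (g h k x y : G).

Definition inside P T := forall x, P x -> par T x.

Definition meets_closed T := forall P Q, parabolic P -> parabolic Q ->
  inside P T -> inside Q T -> parabolic (P `&` Q)%classic.

Lemma inside_conj P T g : par T g -> inside P T -> inside (conj_set g P) T.
Proof.
move=> Tg PT x /PT Px; have -> : x = g * (g^-1 * x * g) * g^-1 by gnorm.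
by apply: parM (parV Tg); apply: parM.
Qed.

Lemma par_inside S T : S \subset T -> inside (par S) T.
Proof. by move=> ST x; apply: par_mono. Qed.

Section TwoSides.
Variables (T : {set V}) (u n : V).
Hypotheses (uT : u \in T) (nT : n \in T) (un : u != n)
  (une : [set u; n] \notin edges Gamma).
Hypothesis IH : forall T', #|T'| < #|T| -> meets_closed T'.
Notation A b := (T :&: side u n b).
Notation C := (T :&: base u n).

Lemma side_smaller b : #|A b| < #|T|.
Proof.
apply: proper_card; rewrite finset.properEneq finset.subsetIl andbT.
by apply: contraNneq (side_notin u n T b) => ->; case: b.
Qed.

Lemma base_sides b : C \subset A b.
Proof. by apply: finset.setIS; apply: base_side. Qed.

Lemma par_sides_base b c x : par (A b) x -> par (A c) x -> b != c -> par C x.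
Proof.
move=> Ab Ac bc; apply: par_mono (parI Gamma_even Ab Ac).
apply/fintype.subsetP => v; rewrite !inE negb_or => /andP[/andP[-> vb] /andP[_ vc]].
by move: bc vb vc; case: (b); case: (c) => // _ -> ->.
Qed.

Lemma meet_sides b c Q R : parabolic Q -> parabolic R ->
  inside Q (A b) -> inside R (A c) -> parabolic (Q `&` R)%classic.
Proof.
move=> pQ pR QA RA; have [bc|bc] := eqVneq b c.
  by subst c; apply: (IH (side_smaller b)).
have pQC : parabolic (Q `&` par C)%classic.
  apply: (IH (side_smaller b)) => //; first exact: par_parabolic.
  exact: par_inside (base_sides b).
have := IH (side_smaller c) pQC pR _ RA.
case=> [x [_]|g [S E]].
  exact: par_inside (base_sides c) _.
exists g, S; rewrite -E predeqE => x; split=> [[Qx Rx]|[[Qx _] Rx]] //.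
by split=> //; split=> //; apply: (par_sides_base (QA _ Qx) (RA _ Rx)).
Qed.

(** Induction on the word s. If the first letter is on the side of Q, or the last
    one on the side of R, it is conjugated into Q or R. Otherwise an element of Q
    and of the conjugate of R lies in the base, since a letter outside the base
    conjugated by s is not in a factor; so Q can be replaced by its intersection
    with the base, which is on both sides. *)
Lemma meet_sides_word m s : size s <= m -> amalgam_words u n T s ->
  forall b c Q R, parabolic Q -> parabolic R ->
  inside Q (A b) -> inside R (A c) -> parabolic (Q `&` conj_set (wprod s) R)%classic.
Proof.
elim: m s => [|m IHm] s sm sr b c Q R pQ pR QA RA.
  case: s sm sr => // _ _; apply: (parabolic_ext _ (meet_sides pQ pR QA RA)) => x.
  by rewrite /setI /conj_set /= invg1 mul1g mulg1.
have same_side b' Q' g s' : s = (b', g) :: s' -> parabolic Q' -> inside Q' (A b') ->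
    parabolic (Q' `&` conj_set (wprod s) R)%classic.
  move=> sE pQ' QA'; rewrite sE in sr sm *.
  have /reduced_word_cons[Ag _ _ sr'] := sr.
  apply: (@parabolic_conjE _ g^-1).
  have pQg := parabolic_conj g^-1 pQ'.
  have QgA : inside (conj_set g^-1 Q') (A b') by apply: inside_conj (parV Ag) QA'.
  apply: (parabolic_ext _ (IHm s' sm sr' b' c _ _ pQg pR QgA RA)) => x.
  by rewrite /setI /conj_set /=; gnorm.
case: s sm sr same_side => [|[d g] s] sm sr same_side.
  apply: (parabolic_ext _ (meet_sides pQ pR QA RA)) => x.
  by rewrite /setI /conj_set /= invg1 mul1g mulg1.
have [db|db] := eqVneq d b.
  by subst d; apply: (same_side b Q g s).
have [s2 [e [h sE]]] := cons_rconsP d g s.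
have [ec|ec] := eqVneq e c.
  subst e; have sr2 : amalgam_words u n T (rcons s2 (c, h)) by rewrite -sE.
  have sr2' : amalgam_words u n T s2.
    by apply: (@reduced_word_catl _ _ _ _ [:: (c, h)]); rewrite cats1.
  have Ah : par (A c) h by case: sr2 => /(_ (c, h)); rewrite mem_rcons mem_head => /(_ isT)[].
  have s2m : size s2 <= m by move: sm; rewrite sE size_rcons.
  have pRh := parabolic_conj h pR.
  have RhA : inside (conj_set h R) (A c) by apply: inside_conj Ah RA.
  apply: (parabolic_ext _ (IHm s2 s2m sr2' b c _ _ pQ pRh QA RhA)) => x.
  by rewrite /setI /conj_set sE -cats1 wprod_cat /= mulg1; gnorm.
have pQC : parabolic (Q `&` par C)%classic.
  apply: meet_sides pQ _ QA _; first exact: par_parabolic.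
  exact: par_inside (base_sides b).
have QCA : inside (Q `&` par C)%classic (A d).
  by move=> x [_]; apply: par_inside (base_sides d) _.
apply: (parabolic_ext _ (same_side d _ g s erefl pQC QCA)) => x.
split=> [[[Qx _] Rx]|[Qx Rx]] //; split=> //; split=> //.
suff Bx : par (base u n) x.
  by apply: par_mono (parI Gamma_even (QA _ Qx) Bx); apply: finset.setSI; apply: finset.subsetIl.
apply: contrapT => nBx.
have Rx' : par (side u n c) ((wprod ((d, g) :: s))^-1 * x * wprod ((d, g) :: s)).
  by apply: par_mono (RA _ Rx); apply: finset.subsetIr.
have Qx' : par (side u n b) x by apply: par_mono (QA _ Qx); apply: finset.subsetIr.
have wr := reduced_word_inv (fun b => par_sub (side u n b)) (par_sub _) (amalgam_wordsT sr).
apply: (conj_word_absurd Gamma_even un une wr Qx' nBx _ Rx'); last by rewrite wprod_inv invgK.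
rewrite unzip1_winv -alternating_rev rev_rcons rev_cons revK.
have s_alt : alternating (unzip1 ((d, g) :: s)) by case: sr.
move: s_alt; rewrite sE [unzip1 _]map_rcons => s_alt.
have bs : alternating (b :: rcons (unzip1 s2) e).
  by move: s_alt; rewrite -[rcons _ _](map_rcons fst s2 (e, h)) -sE /= eq_sym db.
by rewrite -!rcons_cons alternating_rcons rcons_cons bs /= ec.
Qed.

Lemma meet_side_conjugates b c k l Q R : par T k -> par T l ->
  parabolic Q -> parabolic R ->
  inside (conj_set k^-1 Q) (A b) -> inside (conj_set l^-1 R) (A c) ->
  parabolic (Q `&` R)%classic.
Proof.
move=> Tk Tl pQ pR QA RA.
have Tkl : par T (k^-1 * l) by apply: parM Tl; apply: parV.
have [s [a [sr aB klE]]] := amalgam_form Gamma_even un Tkl.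
have Ca := in_base_par Gamma_even aB.
have pQ' := parabolic_conj k^-1 pQ.
have pR' := parabolic_conj a (parabolic_conj l^-1 pR).
have RA' := inside_conj (par_mono (base_sides c) Ca) RA.
apply: (@parabolic_conjE _ k^-1).
apply: (parabolic_ext _ (meet_sides_word (leqnn _) sr pQ' pR' QA RA')) => x.
have sE : wprod s = k^-1 * l * a^-1 by rewrite klE; gnorm.
by rewrite /setI /conj_set /= sE; gnorm; split.
Qed.

(** Let k have a reduced form of minimal length, at least 1, among the elements of
    the double coset G_S k G_S. *)
Section Shortest.
Variables (S : {set V}) (k : G) (b : bool) (g : G) (s : seq (bool * G)) (c : G).
Hypotheses (ST : S \subset T) (sr : amalgam_words u n T ((b, g) :: s)) (Cc : par C c)
  (kE : k = wprod ((b, g) :: s) * c).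
Hypothesis k_min : forall h h' s' c', par S h -> par S h' ->
  amalgam_words u n T s' -> par C c' -> h * k * h' = wprod s' * c' -> size s < size s'.

(** If p g were in the base, p k would have a shorter form. *)
Lemma shortest_mull p : par (S :&: side u n b) p ->
  amalgam_words u n T ((b, p * g) :: s).
Proof.
move=> Sp; have /reduced_word_cons[Ag nBg s_alt sr'] := sr.
have Ap : par (A b) p by apply: par_mono Sp; apply: finset.setSI.
have Sp' : par S p by apply: par_mono Sp; apply: finset.subsetIl.
apply/reduced_word_cons; split=> //; first exact: parM.
move=> Bpg.
have Cpg : par C (p * g).
  apply: par_mono (parI Gamma_even (parM Ap Ag) Bpg).
  by apply: finset.setSI; apply: finset.subsetIl.
have pk : p * k * 1 = p * g * wprod s * c by rewrite kE /=; gnorm.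
case: s sr' s_alt pk k_min => [|[d h] s'] sr' s_alt pk k_min'.
  have := k_min' p 1 [::] (p * g * c) Sp' par1 (@reduced_word_nil _ _ _) (parM Cpg Cc).
  by rewrite pk /= mulg1 mul1g => /(_ erefl).
have sr2 : amalgam_words u n T ((d, p * g * h) :: s').
  have /reduced_word_cons[Ah nBh s_alt' sr''] := sr'.
  apply/reduced_word_cons; split=> //.
    by apply: parM Ah; apply: par_mono Cpg; apply: base_sides.
  by move=> /(subgroupMl (par_sub _) Bpg).
have := k_min' p 1 _ c Sp' par1 sr2 Cc.
by rewrite pk /= !mulgA ltnn => /(_ erefl).
Qed.

(** The form of h is appended to that of k. If the last letter of k and the first
    one of h have the same side, they merge to a letter outside the base by
    minimality, so no cancellation reaches the first letter of k. *)
Lemma shortest_mulr h : par S h ->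
  exists s' c', [/\ amalgam_words u n T s', par C c', k * h = wprod s' * c'
    & exists g' s'', s' = (b, g') :: s''].
Proof.
move=> Sh; have [t [a [tr aB hE]]] := amalgam_form Gamma_even un Sh.
have Ca : par C a by apply: par_mono (in_base_par Gamma_even aB); apply: finset.setSI.
have trT := amalgam_words_mono ST tr.
case: t tr trT hE => [|[d h1] t] tr trT hE.
  exists ((b, g) :: s), (c * a); split=> //; [exact: parM| |by exists g, s].
  by rewrite kE hE /= mul1g mulgA.
have /reduced_word_cons[Ah1 nBh1 t_alt trT'] := trT.
have Bc : par (base u n) c by apply: par_mono Cc; apply: finset.subsetIr.
have Ach : par (A d) (c * h1) by apply: parM Ah1; apply: par_mono Cc; apply: base_sides.
have nBch : ~ par (base u n) (c * h1) by move=> /(subgroupMl (par_sub _) Bc).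
have [s2 [e [f sE]]] := cons_rconsP b g s.
have sr2 : amalgam_words u n T (rcons s2 (e, f)) by rewrite -sE.
have s_alt : alternating (rcons (unzip1 s2) e).
  by case: sr2 => _; rewrite [unzip1 _]map_rcons.
have [ed|ed] := eqVneq e d; last first.
  exists (((b, g) :: s) ++ (d, c * h1) :: t), a; split=> //.
  - apply: reduced_word_cat => //; first by apply/reduced_word_cons; split.
    rewrite sE [unzip1 _]map_cat map_rcons map_cons alternating_cat s_alt /= ed.
    exact: t_alt.
  - by rewrite kE hE wprod_cat /=; gnorm.
  - by exists g, (s ++ (d, c * h1) :: t).
subst e; have [Af nBf] : par (A d) f /\ ~ par (base u n) f.
  by case: sr2 => /(_ (d, f)); rewrite mem_rcons mem_head => /(_ isT).
have Afch : par (A d) (f * (c * h1)) by apply: parM.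
have s2r : amalgam_words u n T s2.
  by apply: (@reduced_word_catl _ _ _ _ [:: (d, f)]); rewrite cats1.
have Sh1 : par S h1.
  case: tr => /(_ (d, h1) (mem_head _ _))[Sh1 _] _.
  by apply: par_mono Sh1; apply: finset.subsetIl.
have kh1 : 1 * k * h1 = wprod s2 * (f * (c * h1)).
  by rewrite kE sE -cats1 wprod_cat /=; gnorm.
have nBfch : ~ par (base u n) (f * (c * h1)).
  move=> Bfch.
  have Cfch : par C (f * (c * h1)).
    apply: par_mono (parI Gamma_even Afch Bfch).
    by apply: finset.setSI; apply: finset.subsetIl.
  have := k_min par1 Sh1 s2r Cfch kh1.
  by have := congr1 size sE; rewrite size_rcons /= => -[->]; rewrite ltnn.
exists (s2 ++ (d, f * (c * h1)) :: t), a; split=> //.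
- apply: reduced_word_cat => //; first by apply/reduced_word_cons; split.
  rewrite [unzip1 _]map_cat map_cons alternating_cat1 s_alt.
  exact: t_alt.
- have -> : k * h = 1 * k * h1 * wprod t * a by rewrite hE /=; gnorm.
  by rewrite kh1 wprod_cat /=; gnorm.
case: s2 sE {sr2 s_alt s2r kh1} => [|[b' g'] s2] /= [bE gE sE].
  by exists (f * (c * h1)), t; rewrite bE.
by exists g', (s2 ++ (d, f * (c * h1)) :: t); rewrite bE.
Qed.
End Shortest.
End TwoSides.
End Intersections.

(** * Conjugates of a standard parabolic subgroup *)

Section DoubleCosets.
Variables (Gamma : artin_graph) (Gamma_even : even_graph Gamma).
Notation V := (vertex Gamma).
Notation G := (artin_group Gamma).
Notation gen := (@artin_gen Gamma).
Notation par := (@standard_parabolic Gamma).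
Implicit Types (S T : {set V}) (P Q R : set G) (g h k x y : G).

Definition meet_conj S k : set G := (par S `&` conj_set k (par S))%classic.

Lemma meet_conj_coset S h k h' : par S h -> par S h' ->
  parabolic (meet_conj S (h * k * h')) -> parabolic (meet_conj S k).
Proof.
move=> Sh Sh' pk; apply: (@parabolic_conjE _ h).
apply: (parabolic_ext _ pk) => x.
rewrite /meet_conj /setI /conj_set /=; split=> -[Sx Tx]; split.
- by apply: parM => //; apply: parM => //; apply: parV.
- have -> : k^-1 * (h^-1 * x * h) * k = h' * ((h * k * h')^-1 * x * (h * k * h')) * h'^-1.
    by gnorm.
  by apply: parM (parV Sh'); apply: parM.
- have -> : x = h * (h^-1 * x * h) * h^-1 by gnorm.
  by apply: parM (parV Sh); apply: parM.
have -> : (h * k * h')^-1 * x * (h * k * h') = h'^-1 * (k^-1 * (h^-1 * x * h) * k) * h'.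
  by gnorm.
by apply: parM => //; apply: parM => //; apply: parV.
Qed.

Section Dichotomy.
Variables (T : {set V}) (u n : V).
Hypotheses (uT : u \in T) (nT : n \in T) (un : u != n)
  (une : [set u; n] \notin edges Gamma).
Hypothesis IH : forall T', #|T'| < #|T| -> meets_closed T'.
Notation A b := (T :&: side u n b).
Notation C := (T :&: base u n).

(** Replace k by an element k0 of minimal length in its double coset, of length at
    least 1 and first letter of side b. An element x of the intersection lies on
    side b: otherwise x = p t q with t nonempty starting and ending on the other
    side, and comparing x k0 with k0 y for some y in G_S gives a reduced word equal
    to an element of the base. So G_S can be replaced by its part on side b, and
    after retracting also in the conjugate. *)
Lemma meet_conj_dichotomy S k : S \subset T -> par T k ->
  parabolic (meet_conj S k) \/
  exists h h' a, [/\ par S h, par S h', par C a & k = h * a * h'].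
Proof.
move=> ST Tk.
pose form (m : nat) := `[< exists h h' s c, [/\ par S h, par S h', amalgam_words u n T s,
  par C c & h * k * h' = wprod s * c] /\ size s = m >].
have ex_form : exists m, form m.
  have [s [c [sr cB kE]]] := amalgam_form Gamma_even un Tk.
  exists (size s); apply/asboolP; exists 1, 1, s, c; split=> //.
  by split=> //; [exact: par1|exact: par1|exact: (in_base_par Gamma_even)|rewrite mul1g mulg1].
case: (ex_minnP ex_form) => m /asboolP[h [h' [s [c [[Sh Sh' sr Cc kE] sm]]]]] m_min.
case: s sr kE sm => [|[b g] s] sr kE sm.
  right; exists h^-1, h'^-1, c; split=> //; [exact: parV | exact: parV |].
  have -> : c = h * k * h' by rewrite kE /= mul1g.
  by gnorm.
left; apply: (meet_conj_coset Sh Sh'); rewrite kE; set k0 := wprod _ * c.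
have k0_min h1 h2 s' c' : par S h1 -> par S h2 -> amalgam_words u n T s' ->
    par C c' -> h1 * k0 * h2 = wprod s' * c' -> size s < size s'.
  move=> Sh1 Sh2 sr' Cc' k'E; rewrite -[_ < _]/(size ((b, g) :: s) <= size s') sm.
  apply: m_min; apply/asboolP; exists (h1 * h), (h' * h2), s', c'; split=> //.
  split=> //; [exact: parM|exact: parM|rewrite -k'E /k0 -kE; by gnorm].
have k0E : k0 = wprod ((b, g) :: s) * c by [].
have side_only x : par S x -> par S (k0^-1 * x * k0) -> par (side u n b) x.
  move=> Sx Sy.
  have [p [t [q [Sp Sq xE tr t_alt]]]] := has_form_split
    (fun b => par_sub (S :&: side u n b)) b (amalgam_form Gamma_even un Sx).
  case: t_alt => [t0|t_alt].
    rewrite xE t0 /= mulg1.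
    by apply: par_mono (parM Sp Sq); apply: finset.subsetIr.
  exfalso.
  have s1r := shortest_mull Gamma_even ST sr Cc k0E k0_min (parV Sp).
  have s2r := shortest_mull Gamma_even ST sr Cc k0E k0_min Sq.
  have Sq' : par S q by apply: par_mono Sq; apply: finset.subsetIl.
  have k2E : q * k0 = wprod ((b, q * g) :: s) * c by rewrite k0E /=; gnorm.
  have k2_min h1 h2 s' c' : par S h1 -> par S h2 -> amalgam_words u n T s' ->
      par C c' -> h1 * (q * k0) * h2 = wprod s' * c' -> size s < size s'.
    by move=> Sh1 Sh2 sr' Cc'; rewrite mulgA; apply: k0_min => //; apply: parM.
  have [s3 [c3 [s3r Cc3 k3E [g3 [s3' s3E]]]]] :=
    shortest_mulr Gamma_even un ST s2r Cc k2E k2_min (parV Sy).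
  pose W := winv ((b, p^-1 * g) :: s) ++ t ++ s3.
  have WB : wprod W = c * c3^-1.
    have -> : c3 = (wprod s3)^-1 * (q * k0 * (k0^-1 * x * k0)^-1) by rewrite k3E; gnorm.
    have -> : c = (wprod ((b, p^-1 * g) :: s))^-1 * (p^-1 * k0) by rewrite k0E /=; gnorm.
    by rewrite /W !wprod_cat wprod_inv xE; gnorm.
  have WBin : par (base u n) (wprod W).
    rewrite WB; have CB := finset.subsetIr T (base u n).
    by apply: parM; [|apply: parV]; apply: par_mono CB _ _.
  suff Wr : reduced_word (fun b => par (side u n b)) (par (base u n)) W.
    have := amalgam_notin Gamma_even un une Wr WBin => /(congr1 size).
    by rewrite /W s3E !size_cat /= !addnS.
  have s_alt : alternating (rcons (rev (unzip1 s)) b).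
    by rewrite -rev_cons alternating_rev; case: sr.
  apply: reduced_word_cat.
  - exact: (reduced_word_inv (fun b => par_sub (side u n b)) (par_sub _) (amalgam_wordsT s1r)).
  - apply: reduced_word_cat; [exact: amalgam_wordsT tr|exact: amalgam_wordsT s3r|].
    rewrite [unzip1 _]map_cat s3E map_cons alternating_cat1.
    have [_ -> _ _] := alternating_around t_alt.
    by case: s3r => _; rewrite s3E.
  rewrite [unzip1 _]map_cat -/(unzip1 (winv _)) unzip1_winv map_cat s3E map_cons.
  rewrite [rev _]rev_cons catA alternating_cat1 rcons_cat cat_rcons alternating_cat1.
  by rewrite s_alt [alternating (_ :: rcons _ _)]t_alt; case: s3r => _; rewrite s3E.
pose r := retract S k0^-1.
have Tr : par T r by apply: par_mono ST _ (retract_in Gamma_even S k0^-1).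
have Tk0 : par T k0.
  rewrite /k0 -kE; apply: parM; last exact: par_mono ST _ Sh'.
  by apply: parM => //; apply: par_mono ST _ Sh.
have pQ := par_parabolic (S :&: side u n b).
have pR := parabolic_conj (k0 * r) (par_parabolic (S :&: (S :&: side u n b))).
have SA : S :&: side u n b \subset A b by apply: finset.setSI.
apply: (parabolic_ext _ (@meet_side_conjugates _ Gamma_even T u n uT nT un une IH b b
  1 (k0 * r) _ _ par1 (parM Tk0 Tr) pQ pR _ _)) => [x||]; last first.
- move=> y; rewrite /conj_set /=; gnorm => Sy; apply: par_mono Sy.
  by apply: fintype.subset_trans SA; apply: finset.subsetIr.
- move=> y; rewrite /conj_set /=; gnorm; exact: par_mono.
have E := par_conjI Gamma_even S (S :&: side u n b) k0^-1 (k0^-1 * x * k0).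
move: E; rewrite -/r; have -> : k0^-1^-1 * (k0^-1 * x * k0) * k0^-1 = x by gnorm.
have -> : r^-1 * (k0^-1 * x * k0) * r = (k0 * r)^-1 * x * (k0 * r) by gnorm.
move=> E; rewrite /meet_conj /setI /conj_set /=; split.
  move=> [Sx Rx]; have [Sy _] := E.2 (conj Rx Sx).
  by split=> //; apply: par_mono Sx; apply: finset.subsetIl.
move=> [Sx Sy]; have Sx' := parI Gamma_even Sx (side_only x Sx Sy).
by have [Rx _] := E.1 (conj Sy Sx').
Qed.
End Dichotomy.
End DoubleCosets.

(** * Removing one vertex *)

Section Main.
Variables (Gamma : artin_graph) (Gamma_even : even_graph Gamma)
  (Gamma_FC : FC_type Gamma).
Notation V := (vertex Gamma).
Notation G := (artin_group Gamma).
Notation gen := (@artin_gen Gamma).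
Notation par := (@standard_parabolic Gamma).
Implicit Types (S T Y : {set V}) (P Q R : set G) (g h k x y : G).

(** If k^-1 h k is in G_S, it equals its retraction, which is h. *)
Lemma meet_conj_centralizer S k : retract S k = 1 ->
  parabolic (fun h => par S h /\ commute h k)%classic <-> parabolic (meet_conj S k).
Proof.
move=> k1; suff -> : meet_conj S k = (fun h => par S h /\ commute h k) by [].
rewrite predeqE => h; split=> -[Sh Sk]; split=> //.
  have := retract_id Gamma_even Sk.
  rewrite !(retractM Gamma_even) (retractV Gamma_even) k1 (retract_id Gamma_even Sh).
  rewrite invg1 mul1g mulg1 => hE.
  by rewrite /commute [h in RHS]hE; gnorm.
by rewrite /conj_set -mulgA Sk mulKg.
Qed.

Lemma retract_disjoint S Y k : par Y k -> S :&: Y = finset.set0 -> retract S k = 1.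
Proof.
by move=> /(retract_par Gamma_even (S := S)) + SY; rewrite SY; apply: par_set0.
Qed.

Section CorankOne.
Variables (T : {set V}) (x : V).
Hypothesis xT : x \in T.
Hypothesis IH : forall T', #|T'| < #|T| -> meets_closed T'.
Notation D := (T :\ x).

Lemma corank1_nonadjacent u k : u \in T -> u != x -> [set u; x] \notin edges Gamma ->
  par T k -> parabolic (meet_conj D k).
Proof.
move=> uT ux une Tk.
have DE : D = T :&: side u x false by rewrite finset.setDE.
have pQ := par_parabolic D; have pR := parabolic_conj k (par_parabolic D).
apply: (@meet_side_conjugates _ Gamma_even T u x uT xT ux une IH false false
  1 k _ _ par1 Tk pQ pR) => y; rewrite /conj_set DE /=; by gnorm.
Qed.

Hypothesis x_adj : forall v, v \in T -> v != x -> [set x; v] \in edges Gamma.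

(** Choose Y minimal such that the double coset of k meets G_Y. If a vertex y of Y
    other than x had a nonneighbour v in T, the dichotomy for y and v would provide
    a representative without y, whose retraction onto Y is in a smaller subgroup
    and still in the double coset. *)
Lemma corank1_reduce k : par T k -> parabolic (meet_conj D k) \/
  exists Y k', [/\ Y \subset T, par Y k', retract D k' = 1,
    forall (y v : V), y \in Y -> y != x -> v \in T -> v != y -> [set y; v] \in edges Gamma
    & parabolic (meet_conj D k') -> parabolic (meet_conj D k)].
Proof.
move=> Tk.
pose form (m : nat) := `[< exists Y h h', [/\ Y \subset T, par D h, par D h',
  par Y (h * k * h') & #|Y| = m] >].
have ex_form : exists m, form m.
  exists #|T|; apply/asboolP; exists T, 1, 1.
  by split=> //; rewrite ?mul1g ?mulg1 //; exact: par1.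
case: (ex_minnP ex_form) => m /asboolP[Y [h [h' [YT Dh Dh' Yk Ym]]]] m_min.
set k0 := h * k * h' in Yk.
have DT : D \subset T by apply: finset.subsetDl.
have Tk0 : par T k0.
  by apply: parM; [apply: parM => //|]; apply: par_mono DT _ _.
have [Y_adj|Y_nonadj] := pselect (forall (y v : V), y \in Y -> y != x -> v \in T -> v != y ->
    [set y; v] \in edges Gamma).
  right; exists Y, (k0 * (retract D k0)^-1).
  have Ydk : par (D :&: Y) (retract D k0) by apply: retract_par.
  have Dd : par D (retract D k0) := retract_in Gamma_even D k0.
  split=> //.
  - by apply: parM => //; apply: parV; apply: par_mono Ydk; apply: finset.subsetIr.
  - rewrite (retractM Gamma_even) (retractV Gamma_even) (retract_id Gamma_even Dd).
    exact: mulgV.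
  - move=> pk; apply: (meet_conj_coset Dh (parM Dh' (parV Dd))).
    by move: pk; rewrite /k0; gnorm.
left; apply: (meet_conj_coset Dh Dh'); rewrite -/k0.
move: Y_nonadj => /existsNP[y /existsNP[v /not_implyP[yY /not_implyP[yx
  /not_implyP[vT /not_implyP[vy yve]]]]]].
have yT : y \in T by apply: (fintype.subsetP YT).
have yv : y != v by rewrite eq_sym.
have vx : v != x.
  by apply: contra_notN yve => /eqP ->; rewrite finset.setUC; apply: x_adj.
have := meet_conj_dichotomy Gamma_even yT vT yv (introN idP yve) IH DT Tk0.
case=> // -[h1 [h2 [a [Dh1 Dh2 Ca kE]]]]; exfalso.
pose r := retract Y.
have rD g : par D g -> par D (r g).
  by move=> /(retract_par Gamma_even (S := Y)); apply: par_mono; apply: finset.subsetIr.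
have k0E : k0 = r h1 * r a * r h2.
  by rewrite -(retract_id Gamma_even Yk) kE !(retractM Gamma_even).
have Ya := retract_par Gamma_even (S := Y) Ca.
have small : #|Y :&: (T :&: base y v)| < m.
  rewrite -Ym; apply: proper_card; rewrite finset.properEneq finset.subsetIl andbT.
  apply/eqP => E; have : y \in Y :&: (T :&: base y v) by rewrite E.
  by rewrite !inE eqxx !andbF.
suff : m <= #|Y :&: (T :&: base y v)| by rewrite leqNgt small.
apply: m_min; apply/asboolP; exists (Y :&: (T :&: base y v)).
exists ((r h1)^-1 * h), (h' * (r h2)^-1); split=> //.
- by apply: fintype.subset_trans YT; apply: finset.subsetIl.
- by apply: parM Dh; apply: parV; apply: rD.
- by apply: parM Dh' _; apply: parV; apply: rD.
suff -> : (r h1)^-1 * h * k * (h' * (r h2)^-1) = r a by [].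
have -> : (r h1)^-1 * h * k * (h' * (r h2)^-1) = (r h1)^-1 * k0 * (r h2)^-1.
  by rewrite /k0; gnorm.
by rewrite k0E; gnorm.
Qed.

Section Centralizers.
Variables (Y : {set V}) (k : G).
Hypotheses (YT : Y \subset T) (Yk : par Y k) (k1 : retract D k = 1).
Hypothesis Y_adj : forall (y v : V), y \in Y -> y != x -> v \in T -> v != y ->
  [set y; v] \in edges Gamma.

(** G_T is the direct product of the dihedral group on x, u and of G_M, and k lies
    in the dihedral factor, so the centralizer is G_D or G_M. *)
Lemma corank1_dihedral u : u \in Y -> u != x -> label [set x; u] <> 2 ->
  parabolic (fun h => par D h /\ commute h k)%classic.
Proof.
move=> uY ux xu2; have uT := fintype.subsetP YT _ uY.
have xu := x_adj uT ux.
pose M := T :\ x :\ u.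
have M2 v : v \in M -> [/\ label [set x; v] = 2, label [set u; v] = 2,
    [set x; v] \in edges Gamma & [set u; v] \in edges Gamma].
  rewrite !inE => /and3P[vu vx vT].
  have xv := x_adj vT vx; have uv := Y_adj uY ux vT vu; split=> //.
    exact: (FC_triangle Gamma_even Gamma_FC xu xv uv xu2).
  have ux' : [set u; x] \in edges Gamma by rewrite finset.setUC.
  by apply: (FC_triangle Gamma_even Gamma_FC ux' uv xv); rewrite finset.setUC.
have uM a v : a \in [set x; u] -> v \in M -> commute (gen a) (gen v).
  by move=> aU /M2[x2 u2 xv uv]; case/finset.set2P: aU => ->; apply: commute_label2.
have uM' a v : a \in [set u] -> v \in M -> commute (gen a) (gen v).
  by move=> aU; apply: uM; move: aU; rewrite !inE orbC => ->.
have uD : u \in D by rewrite !inE ux.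
have xuk : par [set x; u] k.
  have [|e [m [xe Mm kE]]] := par_setU_commute uM (x := k).
    apply: par_mono Yk; apply: (fintype.subset_trans YT); apply/fintype.subsetP => v.
    by rewrite !inE; case: (v == x); case: (v == u).
  have Mk : retract M k = 1.
    have -> : M = M :&: D by apply/esym/finset.setIidPl; apply: finset.subsetDl.
    by rewrite -(retract_comp Gamma_even) k1 (retract1 Gamma_even).
  have Me : retract M e = 1.
    apply: retract_disjoint xe _; apply/finset.setP => v; rewrite !inE.
    by case: (v == x); case: (v == u) => //=; rewrite andbF.
  have m1 : m = 1.
    by move: Mk; rewrite kE (retractM Gamma_even) Me (retract_id Gamma_even Mm) mul1g.
  by rewrite kE m1 mulg1.
have Dform h : par D h -> exists e m, [/\ par [set u] e, par M m & h = e * m].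
  move=> Dh; apply: (par_setU_commute uM'); apply: par_mono Dh.
  by rewrite -{1}(finset.setD1K uD).
have Mk m : par M m -> commute m k.
  by move=> Mm; apply: commute_sym; apply: (par_commute uM).
have [[e [ue e1 ek]]|none] := pselect (exists e, [/\ par [set u] e, e <> 1 & commute e k]).
  have p1 := half_label_gt1 Gamma_even xu xu2.
  have uk := dihedral_centralizer Gamma_even xu p1 ue e1 xuk ek.
  apply: (parabolic_ext _ (par_parabolic D)) => h; split=> [Dh|[]//]; split=> //.
  move: h Dh; apply: par_ind; first exact: subgroup_centraliserl.
  move=> v vD; have [->//|vu] := eqVneq v u.
  by apply: Mk; apply: par_gen; rewrite finset.in_setD1 vu.
apply: (parabolic_ext _ (par_parabolic M)) => h; split=> [Mh|[Dh hk]].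
  by split; [apply: par_mono Mh; apply: finset.subsetDl|apply: Mk].
have [e [m [ue Mm hE]]] := Dform h Dh.
suff e1 : e = 1 by rewrite hE e1 mul1g.
apply: contrapT => e1; apply: none; exists e; split=> //.
have -> : e = h * m^-1 by rewrite hE mulgK.
apply: commute_sym; apply: commuteM (commute_sym hk) _.
exact/commuteV/commute_sym/Mk.
Qed.

(** Here x commutes with G_Y, so k, which retracts to 1 on T - x, is a power of x. *)
Lemma corank1_cyclic : (forall u, u \in Y -> u != x -> label [set x; u] = 2) ->
  parabolic (fun h => par D h /\ commute h k)%classic.
Proof.
move=> Y2.
have xY a v : a \in [set x] -> v \in Y :\ x -> commute (gen a) (gen v).
  move=> /finset.set1P ->; rewrite !inE => /andP[vx vY].
  by apply: commute_label2 => //; [apply: x_adj => //; apply: (fintype.subsetP YT)|apply: Y2].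
have xk : par [set x] k.
  have [|e [m [xe Mm kE]]] := par_setU_commute xY (x := k).
    apply: par_mono Yk; apply/fintype.subsetP => v.
    by rewrite !inE; case: (v == x).
  have De : retract D e = 1.
    apply: retract_disjoint xe _; apply/finset.setP => v; rewrite !inE.
    by case: (v == x); rewrite ?andbF.
  have Dm : par D m by apply: par_mono Mm; apply: finset.setSD.
  have m1 : m = 1.
    by move: k1; rewrite kE (retractM Gamma_even) De (retract_id Gamma_even Dm) mul1g.
  by rewrite kE m1 mulg1.
have [->|/eqP kn1] := eqVneq k 1.
  apply: (parabolic_ext _ (par_parabolic D)) => h; split=> [Dh|[]//]; split=> //.
  exact: commute1.
have xD : x \notin D by rewrite !inE eqxx.
have D_adj v : v \in D -> [set x; v] \in edges Gamma.
  by rewrite !inE => /andP[vx vT]; apply: x_adj.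
apply: (parabolic_ext _ (par_parabolic (D :&: label2 x))) => h; split=> [Dh|[Dh hk]].
  split; first by apply: par_mono Dh; apply: finset.subsetIl.
  apply: commute_sym; apply: par_commute xk Dh => a v /finset.set1P ->.
  move=> /finset.setIP[vD]; rewrite inE => /eqP v2.
  by apply: commute_label2 => //; apply: D_adj.
exact: (centralizer_par Gamma_even Gamma_FC xD D_adj xk kn1).
Qed.
End Centralizers.
End CorankOne.

Lemma corank1_meet T (x : V) k : (forall T', #|T'| < #|T| -> meets_closed T') ->
  x \in T -> par T k -> parabolic (meet_conj (T :\ x) k).
Proof.
move=> IH xT Tk.
have [x_adj|x_nonadj] := pselect (forall v, v \in T -> v != x -> [set x; v] \in edges Gamma);
  last first.
  move: x_nonadj => /existsNP[u /not_implyP[uT /not_implyP[ux xue]]].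
  by apply: (corank1_nonadjacent xT IH uT ux) => //; rewrite finset.setUC; apply/negP.
have [//|[Y [k' [YT Yk k1 Y_adj]]]] := corank1_reduce IH x_adj Tk; apply.
apply/(meet_conj_centralizer k1).
have [[u [uY ux xu2]]|Y2] := pselect (exists u, [/\ u \in Y, u != x & label [set x; u] <> 2]).
  exact: (corank1_dihedral x_adj YT Yk k1 Y_adj uY ux xu2).
apply: (corank1_cyclic x_adj YT Yk k1) => u uY ux; apply: contrapT => xu2.
by apply: Y2; exists u.
Qed.

(** Let D = T - x and d the retraction of k onto D. By retraction, an element of G_D
    whose conjugate by k d^-1 is in G_D commutes with k d^-1; hence G_S /\ k G_S k^-1
    is the intersection of G_S, d G_S d^-1 and G_D /\ (k d^-1) G_D (k d^-1)^-1,
    which are three parabolic subgroups of G_D. *)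
Lemma meet_conj_proper S T (x : V) k : (forall T', #|T'| < #|T| -> meets_closed T') ->
  x \in T -> S \subset T :\ x -> par T k -> parabolic (meet_conj S k).
Proof.
move=> IH xT SD Tk; pose D := T :\ x; pose d := retract D k.
have Dd : par D d := retract_in Gamma_even D k.
have DT : #|D| < #|T| by rewrite (cardsD1 x T) xT.
have k1 : retract D (k * d^-1) = 1.
  rewrite (retractM Gamma_even) (retractV Gamma_even) (retract_id Gamma_even Dd).
  exact: mulgV.
have Tkd : par T (k * d^-1).
  apply: parM Tk _; apply: parV; apply: par_mono Dd; exact: finset.subsetDl.
have pD := corank1_meet IH xT Tkd; rewrite -/D in pD.
have SD' : inside (par S) D by apply: par_inside.
have dSD : inside (conj_set d (par S)) D by apply: inside_conj.
have kdE h : par D h -> par D ((k * d^-1)^-1 * h * (k * d^-1)) ->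
    (k * d^-1)^-1 * h * (k * d^-1) = h.
  move: (k * d^-1) k1 => c c1 Dh /(retract_id Gamma_even).
  rewrite !(retractM Gamma_even) (retractV Gamma_even) c1.
  by rewrite (retract_id Gamma_even Dh) invg1 mulg1 mul1g.
have pS := par_parabolic S.
have pd := parabolic_conj d pS.
have p2 := IH _ DT _ _ pS pd SD' dSD.
have p3 : parabolic ((par S `&` conj_set d (par S)) `&` meet_conj D (k * d^-1))%classic.
  apply: (IH _ DT _ _ p2 pD) => [h [Sh _]|h [Dh _]] //; exact: SD'.
apply: (parabolic_ext _ p3) => h.
have kE : k^-1 * h * k = d^-1 * ((k * d^-1)^-1 * h * (k * d^-1)) * d by gnorm.
rewrite /meet_conj /setI /conj_set /= kE; split=> [[[Sh dh] [Dh Dkh]]|[Sh Skh]].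
  by split=> //; rewrite kdE.
have Dh := SD' _ Sh.
have Dkh : par D ((k * d^-1)^-1 * h * (k * d^-1)).
  have -> : (k * d^-1)^-1 * h * (k * d^-1) =
    d * (d^-1 * ((k * d^-1)^-1 * h * (k * d^-1)) * d) * d^-1 by gnorm.
  by apply: parM (parV Dd); apply: parM Dd _; apply: SD'.
by split=> //; split=> //; move: Skh; rewrite kdE.
Qed.

(** Two applications of [par_conjI], one for each of the two subgroups. *)
Lemma par_meet_common S S' T k : S \subset T -> S' \subset T -> par T k ->
  exists k1 k2, [/\ par T k1, par T k2 &
  forall h, par S h /\ par S' (k^-1 * h * k) <->
    par (S :&: S') (k1^-1 * h * k1) /\ par (S :&: S') (k2^-1 * h * k2)].
Proof.
move=> ST S'T Tk; pose r := retract S k; pose r' := retract S' (k^-1 * r).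
exists r, (k * r'); split=> [||h].
- exact: par_mono ST _ (retract_in Gamma_even S k).
- by apply: parM Tk _; apply: par_mono S'T _ (retract_in Gamma_even S' _).
have E := par_conjI Gamma_even S S' k h.
have E' := par_conjI Gamma_even S' (S :&: S') (k^-1 * r) (k^-1 * h * k).
have S'' : S' :&: (S :&: S') = S :&: S'.
  by apply/finset.setIidPr; apply: finset.subsetIr.
have e1 : (k^-1 * r)^-1 * (k^-1 * h * k) * (k^-1 * r) = r^-1 * h * r by gnorm.
have e2 : r'^-1 * (k^-1 * h * k) * r' = (k * r')^-1 * h * (k * r') by gnorm.
rewrite -/r in E; rewrite -/r' S'' e1 e2 in E'.
split=> [/E[rh Sk]|[rh r'h]].
  by have [] := E'.1 (conj Sk rh).
by apply/E; have [Sk _] := E'.2 (conj r'h rh).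
Qed.

Lemma all_meets_closed T : meets_closed T.
Proof.
move: {2}(#|T|) (leqnn #|T|) => m; elim: m T => [|m IHm] T Tm P Q pP pQ PT QT;
  have [g [S [Tg ST PE]]] := parabolic_in Gamma_even pP PT.
  move: Tm; rewrite leqn0 cards_eq0 => /eqP T0; subst T.
  apply: (parabolic_ext _ pQ) => x; split=> [Qx|[]//]; split=> //.
  have x1 := par_set0 (QT _ Qx); rewrite x1; exact: subgroup1 (parabolic_sub pP).
have [TS|/fintype.subsetPn[v vT vS]] := boolP (T \subset S).
  apply: (parabolic_ext _ pQ) => x; split=> [Qx|[]//]; split=> //.
  apply/PE; apply: par_mono TS _ _; apply: (parM _ Tg); apply: parM; first exact: parV.
  exact: QT.
have [g' [S' [Tg' ST' QE]]] := parabolic_in Gamma_even pQ QT.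
have IH T' : #|T'| < #|T| -> meets_closed T'.
  by move=> T'T; apply: IHm; rewrite -ltnS; apply: leq_trans T'T Tm.
have [k1 [k2 [Tk1 Tk2 kE]]] := par_meet_common ST ST' (parM (parV Tg) Tg').
have Sv : S :&: S' \subset T :\ v.
  rewrite finset.subsetD1; apply/andP; split.
    by apply: fintype.subset_trans ST; apply: finset.subsetIl.
  by rewrite inE (negPf vS).
have pk := meet_conj_proper IH vT Sv (parM (parV Tk1) Tk2).
apply: (@parabolic_conjE _ g^-1).
apply: (parabolic_ext _ (parabolic_conj k1 pk)) => h.
have e1 : (k1^-1 * k2)^-1 * (k1^-1 * h * k1) * (k1^-1 * k2) = k2^-1 * h * k2 by gnorm.
have e2 : (g^-1 * g')^-1 * h * (g^-1 * g') = g'^-1 * (g^-1^-1 * h * g^-1) * g' by gnorm.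
have e3 : g^-1 * (g^-1^-1 * h * g^-1) * g = h by gnorm.
rewrite /meet_conj /setI /conj_set /= e1; split.
  by move=> /kE; rewrite e2 => -[Sh S'h]; rewrite PE QE e3.
by rewrite PE QE e3 -e2 => /kE.
Qed.
End Main.

Local Open Scope classical_set_scope.

Theorem theorem1p1 (Gamma : artin_graph)
    (Gamma_even : even_graph Gamma) (Gamma_FC : FC_type Gamma)
    (P1 P2 : set (artin_group Gamma)) :
  parabolic P1 -> parabolic P2 -> parabolic (P1 `&` P2).
Proof.
move=> p1 p2.
by apply: (all_meets_closed Gamma_even Gamma_FC (T := [set: vertex Gamma]%SET) p1 p2) =>
  x _; apply: par_full.
Qed.
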